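(* A language is threshold dot-depth one if and only if it belongs to $\mathcal{L}(\mathbf{DA}) \cap \mathcal{L}(\mathbf{J} * \mathbf{D}) = \mathcal{L}(\langle \mathbf{DA} \rangle_{S} \cap \mathbf{J} * \mathbf{D})$.
   Context: All alphabets are finite. Threshold dot-depth one languages. A word $u$ is a subword of $w$ if it is a (not necessarily contiguous) subsequence of $w$. Let $\Sigma$ be an alphabet. For $u \in \Sigma^*$, let $\mathrm{Sub}(u) \subseteq \Sigma^*$ be the language of all words over $\Sigma$ having $u$ as a subword. For $u \in \Sigma^+$ and $l \in \mathbb{N}_{>0}$, let $[u]_l = \Sigma^* u \Sigma^* \cup \mathrm{Sub}(u^l)$. For $k \geq 2$ and $u_1, \ldots, u_k \in \Sigma^+$, let $[u_1, \ldots, u_k]_l = [u_1]_l [u_2]_l \cdots [u_k]_l$ (concatenation of languages). A threshold dot-depth one language over $\Sigma$ is any Boolean combination of languages over $\Sigma$ of the form $\Sigma^* u$, $u \Sigma^*$ and $[u_1, \ldots, u_k]_l$, for $k, l \in \mathbb{N}_{>0}$ and $u, u_1, \ldots, u_k \in \Sigma^+$. Varieties. A variety of monoids (resp. semigroups) is a class of finite monoids (resp. semigroups) closed under submonoids (resp. subsemigroups), finite Cartesian products and morphic images. For a language $L \subseteq \Sigma^*$, its syntactic semigroup is the image of $\Sigma^+$ under the syntactic morphism of $L$. For a variety $\mathbf{V}$ of monoids (resp. semigroups), $\mathcal{L}(\mathbf{V})$ is the class of languages whose syntactic monoid (resp. syntactic semigroup) belongs to $\mathbf{V}$. The idempotent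 power of a finite monoid $M$ is the smallest $\omega \in \mathbb{N}_{>0}$ with $x^\omega = x^{2\omega}$ for all $x \in M$. $\mathbf{DA}$ is the variety of finite monoids $M$, of idempotent power $\omega$, such that $(xy)^\omega = (xy)^\omega x (xy)^\omega$ for all $x, y \in M$. $\langle \mathbf{DA} \rangle_{S}$ is the smallest variety of semigroups containing $\mathbf{DA}$. Dot-depth one. A dot-depth one language over $\Sigma$ is a Boolean combination of languages of the form $\Sigma^* u$, $u \Sigma^*$ and $\Sigma^* u_1 \Sigma^* \cdots \Sigma^* u_k \Sigma^*$ for $k \in \mathbb{N}_{>0}$ and $u, u_1, \ldots, u_k \in \Sigma^+$. $\mathbf{J} * \mathbf{D}$ denotes the inclusion-wise smallest variety of semigroups containing all syntactic semigroups of dot-depth one languages; it is known that $\mathcal{L}(\mathbf{J} * \mathbf{D})$ is exactly the class of dot-depth one languages. *)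

(* Defs.v *)
From HB Require Import structures.
From mathcomp Require Import all_boot.
From mathcomp Require Import boolp classical_sets functions cardinality.

Set Implicit Arguments.
Unset Strict Implicit.
Unset Printing Implicit Defensive.

Local Open Scope classical_set_scope.

Notation language Sigma := (set (seq Sigma)).

Definition lang_cat (Sigma : finType) (L K : language Sigma) : language Sigma :=
  [set x ++ y | x in L & y in K].

Definition suffix_lang (Sigma : finType) (u : seq Sigma) : language Sigma :=
  lang_cat setT [set u].

Definition prefix_lang (Sigma : finType) (u : seq Sigma) : language Sigma :=
  lang_cat [set u] setT.

Definition factor_lang (Sigma : finType) (u : seq Sigma) : language Sigma :=
  lang_cat (lang_cat setT [set u]) setT.

Definition Sub_lang (Sigma : finType) (u : seq Sigma) : language Sigma :=
  [set w | subseq u w].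

Definition word_pow (Sigma : finType) (u : seq Sigma) (l : nat) : seq Sigma :=
  flatten (nseq l u).

(** With [us = [:: u_1; ...; u_k]], the two definitions below are [u]_l and
    [u_1, ..., u_k]_l respectively. *)
Definition threshold_block (Sigma : finType) (l : nat) (u : seq Sigma) :
    language Sigma :=
  factor_lang u `|` Sub_lang (word_pow u l).

Definition threshold_lang (Sigma : finType) (l : nat) (us : seq (seq Sigma)) :
    language Sigma :=
  \big[@lang_cat Sigma/[set [::]]]_(u <- us) threshold_block l u.

Definition marked_lang (Sigma : finType) (us : seq (seq Sigma)) :
    language Sigma :=
  lang_cat setT
    (\big[@lang_cat Sigma/[set [::]]]_(u <- us) lang_cat [set u] setT).

(** Intersections are obtained by De Morgan.  The empty combination [set0]
    only matters when there are no generators, i.e. over the empty alphabet. *)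
Inductive bool_comb (T : Type) (G : set (set T)) : set T -> Prop :=
| bool_comb_gen A : G A -> bool_comb G A
| bool_comb0 : bool_comb G set0
| bool_combU A B : bool_comb G A -> bool_comb G B -> bool_comb G (A `|` B)
| bool_combC A : bool_comb G A -> bool_comb G (~` A).

Inductive threshold_gen (Sigma : finType) : language Sigma -> Prop :=
| threshold_gen_suffix u : u <> [::] -> threshold_gen (suffix_lang u)
| threshold_gen_prefix u : u <> [::] -> threshold_gen (prefix_lang u)
| threshold_gen_block l us : 0 < l -> us <> [::] ->
    (forall u, u \in us -> u <> [::]) -> threshold_gen (threshold_lang l us).

Inductive dot_depth_one_gen (Sigma : finType) : language Sigma -> Prop :=
| dot_depth_one_gen_suffix u : u <> [::] -> dot_depth_one_gen (suffix_lang u)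
| dot_depth_one_gen_prefix u : u <> [::] -> dot_depth_one_gen (prefix_lang u)
| dot_depth_one_gen_marked us : us <> [::] ->
    (forall u, u \in us -> u <> [::]) -> dot_depth_one_gen (marked_lang us).

Definition threshold_dot_depth_one (Sigma : finType) (L : language Sigma) :
    Prop :=
  bool_comb (@threshold_gen Sigma) L.

Definition dot_depth_one (Sigma : finType) (L : language Sigma) : Prop :=
  bool_comb (@dot_depth_one_gen Sigma) L.

Definition synt_cong (Sigma : finType) (L : language Sigma) : rel (seq Sigma) :=
  fun u v => `[< forall x y, L (x ++ u ++ y) <-> L (x ++ v ++ y) >].

Section SyntacticMonoid.
Variables (Sigma : finType) (L : language Sigma).

Lemma synt_cong_refl : reflexive (synt_cong L).
Proof. by move=> u; apply/asboolP. Qed.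

Lemma synt_cong_sym : symmetric (synt_cong L).
Proof.
move=> u v; apply/asboolP/asboolP => uv x y; exact: iff_sym (uv x y).
Qed.

Lemma synt_cong_trans : transitive (synt_cong L).
Proof.
move=> v u w /asboolP uv /asboolP vw; apply/asboolP => x y.
exact: iff_trans (uv x y) (vw x y).
Qed.

Lemma synt_cong_cat u u' v v' :
  synt_cong L u u' -> synt_cong L v v' -> synt_cong L (u ++ v) (u' ++ v').
Proof.
move=> /asboolP uu' /asboolP vv'; apply/asboolP => x y.
rewrite -!catA; apply: iff_trans (uu' _ _) _.
by rewrite !(catA x); apply: vv'.
Qed.

Canonical synt_cong_equiv :=
  EquivRel (synt_cong L) synt_cong_refl synt_cong_sym synt_cong_trans.

Definition synt_monoid : Type := {eq_quot synt_cong L}%qT.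

HB.instance Definition _ := Choice.on synt_monoid.

Definition synt_morph (w : seq Sigma) : synt_monoid :=
  (\pi_({eq_quot synt_cong L}) w)%qT.

Definition synt_mul (a b : synt_monoid) : synt_monoid :=
  synt_morph (repr a ++ repr b).

Lemma synt_morph_eq u v : synt_morph u = synt_morph v <-> synt_cong L u v.
Proof. by split=> [/eqmodP|uv] //; apply/eqmodP. Qed.

Lemma synt_morph_repr (a : synt_monoid) : synt_morph (repr a) = a.
Proof. exact: reprK. Qed.

Lemma synt_morphM u v :
  synt_morph (u ++ v) = synt_mul (synt_morph u) (synt_morph v).
Proof.
by apply/synt_morph_eq/synt_cong_cat; apply/synt_morph_eq;
  rewrite synt_morph_repr.
Qed.

Lemma synt_mulA : associative synt_mul.
Proof.
move=> a b c; rewrite -(synt_morph_repr a) -(synt_morph_repr b).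
by rewrite -(synt_morph_repr c) -!synt_morphM catA.
Qed.

Lemma synt_mul1 : left_id (synt_morph [::]) synt_mul.
Proof.
by move=> a; rewrite -(synt_morph_repr a) -synt_morphM.
Qed.

Lemma synt_mulr1 : right_id (synt_morph [::]) synt_mul.
Proof.
by move=> a; rewrite -(synt_morph_repr a) -synt_morphM cats0.
Qed.

HB.instance Definition _ :=
  isMonoid.Build synt_monoid synt_mulA synt_mul1 synt_mulr1.

(** The image of [Sigma^+] under the syntactic morphism. *)
Definition synt_plus : pred synt_monoid :=
  fun a => `[< exists2 w, w <> [::] & synt_morph w = a >].

Lemma synt_plus_mul : mulg_closed synt_plus.
Proof.
move=> _ _ /asboolP[u u0 <-] /asboolP[v _ <-]; apply/asboolP.
by exists (u ++ v); [case: u u0 | exact: synt_morphM].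
Qed.

Definition synt_semigroup : Type := {a : synt_monoid | synt_plus a}.

HB.instance Definition _ := SubChoice.on synt_semigroup.
HB.instance Definition _ :=
  SubChoice_isSubSemigroup.Build synt_monoid synt_plus synt_semigroup
    synt_plus_mul.

End SyntacticMonoid.

Section ProdSemigroup.
Variables (I : finType) (S : I -> semigroupType).

Definition prod_semigroup : Type := {dffun forall i, S i}.

HB.instance Definition _ := Choice.on prod_semigroup.

Definition prod_mul (f g : prod_semigroup) : prod_semigroup :=
  [ffun i => (f i * g i)%g].

Lemma prod_mulA : associative prod_mul.
Proof. by move=> f g h; apply/ffunP => i; rewrite !ffunE mulgA. Qed.

HB.instance Definition _ := isSemigroup.Build prod_semigroup prod_mulA.

End ProdSemigroup.

(** Semigroups may be empty: [synt_semigroup L] is, over the empty alphabet.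
    A subsemigroup is any [T] with a multiplicative [val : T -> S] identifying
    it with the elements satisfying [P]. *)
Record variety (V : semigroupType -> Prop) : Prop := Variety {
  variety_finite : forall S : semigroupType, V S -> finite_set [set: S];
  variety_sub : forall (S : semigroupType) (P : pred S)
    (T : subSemigroupType P), V S -> V T;
  variety_prod : forall (I : finType) (S : I -> semigroupType),
    (forall i, V (S i)) -> V (prod_semigroup S);
  variety_image : forall (S T : semigroupType) (f : {multiplicative S -> T}),
    set_surj setT setT f -> V S -> V T
}.

(** The smallest variety containing [C], as an intersection of varieties. *)
Definition generated_variety (C : semigroupType -> Prop) (S : semigroupType) :
    Prop :=
  forall V, variety V -> (forall T, C T -> V T) -> V S.

(** Membership in [V] carries the finiteness of the syntactic monoid (resp.
    semigroup), which is defined for every language. *)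
Definition monoid_langs (V : monoidType -> Prop) (Sigma : finType) :
    set (language Sigma) :=
  [set L | V (synt_monoid L)].

Definition semigroup_langs (V : semigroupType -> Prop) (Sigma : finType) :
    set (language Sigma) :=
  [set L | V (synt_semigroup L)].

Arguments monoid_langs V Sigma : clear implicits.
Arguments semigroup_langs V Sigma : clear implicits.

Definition idempotent_exponent (M : monoidType) (n : nat) : Prop :=
  0 < n /\ forall x : M, (x ^+ n = x ^+ (2 * n)%N)%g.

Definition idempotent_power (M : monoidType) (w : nat) : Prop :=
  idempotent_exponent M w /\ forall n, idempotent_exponent M n -> w <= n.

Definition DA (M : monoidType) : Prop :=
  finite_set [set: M] /\
  exists2 w, idempotent_power M w &
    forall x y : M, ((x * y) ^+ w = (x * y) ^+ w * x * (x * y) ^+ w)%g.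

(** The members of [DA] are viewed as semigroups by forgetting their unit. *)
Definition DA_S : semigroupType -> Prop :=
  generated_variety (fun S => exists2 M : monoidType, DA M & S = M).

Definition JstarD : semigroupType -> Prop :=
  generated_variety (fun S => exists (Sigma : finType) (L : language Sigma),
    dot_depth_one L /\ S = synt_semigroup L).

(* Main.v *)
(** Let L have a syntactic monoid in DA and a syntactic semigroup in J*D.

    The class of finite semigroups all of whose morphisms from free semigroups
    factor through "same prefix, same short subwords of the sequence of
    n-windows" is a variety that contains the syntactic semigroups of dot-depth
    one languages, so L only depends on short prefixes, suffixes and marked
    tests [Sigma^* u_1 Sigma^* ... u_k Sigma^*].

    In DA one has [x^w z x^w = x^w] when the letters of z occur in x.  Hence
    between two long products of words with the same alphabet A one may insert
    a word containing all short words over A as factors without leaving the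
    syntactic class.  If [u^l] is a subword for a large l, such a place exists
    with A containing the letters of u, so u can be made a factor.  Conversely
    the insertions do not enlarge the set of threshold tests satisfied with a
    much smaller l.  The set of satisfied tests decreases with l, so it is the
    same for two consecutive terms of a fast growing sequence of thresholds; for
    these, saturating a word by insertions turns its threshold tests into
    exactly its marked tests.  Thus words satisfying the same threshold tests
    become equivalent for L.

    The other inclusion uses the same two facts on insertions, applied to
    [(xy)^n x (xy)^n]. *)

Require Import Defs.
From mathcomp Require Import all_boot.
From mathcomp Require Import boolp classical_sets functions cardinality.
From mathcomp Require Import zify.

Set Implicit Arguments.
Unset Strict Implicit.
Unset Printing Implicit Defensive.

(** * Words *)

Section Words.
Variable T : eqType.
Implicit Types (s t u v w x y : seq T).

Lemma cat_eq_cat s t u v : s ++ t = u ++ v ->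
  (exists e, s = u ++ e /\ v = e ++ t) \/ (exists e, u = s ++ e /\ t = e ++ v).
Proof.
elim: s u => [|a s IH] [|b u] /= E.
- by left; exists [::].
- by right; exists (b :: u); rewrite E.
- by left; exists (a :: s); rewrite -E.
- case: E => -> /IH [[e [-> ->]]|[e [-> ->]]]; [left|right]; by exists e.
Qed.

Lemma subseq_cat_split s t u : subseq s (t ++ u) ->
  exists s1 s2, [/\ s = s1 ++ s2, subseq s1 t & subseq s2 u].
Proof.
case/subseqP => m sz ->; exists (mask (take (size t) m) t).
exists (mask (drop (size t) m) u); split; rewrite ?mask_subseq //.
rewrite -[in LHS](cat_take_drop (size t) m) mask_cat //.
by rewrite size_take sz size_cat; case: ltnP; lia.
Qed.

Lemma cat_subseq_split s t u : subseq (s ++ t) u ->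
  exists u1 u2, [/\ u = u1 ++ u2, subseq s u1 & subseq t u2].
Proof.
elim: u s => [|a u IH] s /=.
  by rewrite -size_eq0 size_cat => /eqP; case: s t => [|//] [|//] _; exists [::], [::].
case: s => [|b s] /=; first by move=> H; exists [::], (a :: u).
case: ifP => [/eqP -> /IH|_ /(IH (b :: s))] [u1 [u2 [-> ? ?]]];
  exists (a :: u1), u2; split=> //=; first by rewrite eqxx.
by case: ifP => // _; apply: cons_subseq; eassumption.
Qed.

Lemma subseq_cat_drop s t u : subseq (s ++ t) u -> subseq t (drop (size s) u).
Proof.
case/cat_subseq_split => u1 [u2 [-> /size_subseq le1 H]].
rewrite drop_cat; case: ltnP => le2.
  exact: subseq_trans H (suffix_subseq _ _).
by have ->: size s - size u1 = 0; [lia | rewrite drop0].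
Qed.

Lemma infix_cat_split u s t : infix u (s ++ t) ->
  [\/ infix u s, infix u t |
    exists v w, [/\ u = v ++ w, suffix v s & prefix w t]].
Proof.
case/infixP => x [y E]; case: (cat_eq_cat E) => [] [e [E1 E2]].
  case: (cat_eq_cat (esym E2)) => [] [f [E3 E4]].
    by constructor 1; rewrite E1 E3 infix_infix.
  constructor 3; exists e, f; rewrite E3 E1 E4; split=> //.
    exact: suffix_suffix.
  exact: prefix_prefix.
by constructor 2; rewrite E2 infix_infix.
Qed.

Lemma prefix_catl_le s t u : size s <= size t ->
  prefix s (t ++ u) = prefix s t.
Proof.
move=> le; rewrite !prefixE take_cat; case: ltnP => // le'.
have -> : size s = size t by lia.
by rewrite subnn take0 cats0 take_size.
Qed.

Lemma suffix_catr_le s t u : size s <= size u ->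
  suffix s (t ++ u) = suffix s u.
Proof. by move=> le; rewrite /suffix rev_cat prefix_catl_le // !size_rev. Qed.

Lemma take_prefix_eq n m s t : m <= n -> take n s = take n t -> take m s = take m t.
Proof. by move=> le E; rewrite -(take_takel s le) E take_takel. Qed.

End Words.

Fixpoint words_upto (T : Type) (s : seq T) n : seq (seq T) :=
  if n is n'.+1 then [::] :: [seq a :: w | a <- s, w <- words_upto s n']
  else [:: [::]].

Lemma mem_words_upto (T : eqType) (s : seq T) n w :
  (w \in words_upto s n) = (size w <= n) && all [in s] w.
Proof.
elim: n w => [|n IH] [|a w] //=; rewrite in_cons /= ltnS.
apply/allpairsP/andP => [[[b v] /= [? + [-> ->]]]|[le /andP[? ?]]].
  by rewrite IH => /andP[-> ->]; split=> //; rewrite andbT.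
by exists (a, w); rewrite /= IH le.
Qed.

(** * Chains of blocks, rich words and insertions *)

Section Chains.
Variable Sigma : finType.
Implicit Types (A : {set Sigma}) (u v w x y z s t r : seq Sigma).
Implicit Types (us : seq (seq Sigma)) (b : rel (seq Sigma)).

Definition blk l : rel (seq Sigma) :=
  fun u w => infix u w || subseq (word_pow u l) w.

(** [chain infix us] is [Sigma^* u_1 Sigma^* ... u_k Sigma^*], and
    [chain (blk l) us] is [u_1, ..., u_k]_l with empty words allowed in [us]. *)
Fixpoint chain b us w : Prop :=
  if us is u :: us' then exists x y, [/\ w = x ++ y, b u x & chain b us' y]
  else True.

(** Quantifying over all short suffixes covers words shorter than [N] as well. The point of the
    condition is that an occurrence cut next to [s] has its left half over [A]. *)
Definition near_end N A s :=
  forall v, suffix v s -> size v <= N -> all [in A] v.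

Definition near_start N A t :=
  forall v, prefix v t -> size v <= N -> all [in A] v.

Lemma near_end_suffix N A s s' : suffix s' s -> near_end N A s -> near_end N A s'.
Proof. by move=> S H v vs; apply: H (suffix_trans vs S). Qed.

Lemma near_start_prefix N A t t' :
  prefix t' t -> near_start N A t -> near_start N A t'.
Proof. by move=> S H v vs; apply: H (prefix_trans vs S). Qed.

(** An occurrence that straddles the cut splits into a short suffix of [s] and a short prefix of
    [t], both over [A]. Any other occurrence survives the insertion. *)
Lemma infix_insert N A u z s t : size u <= N ->
    near_end N A s -> near_start N A t -> infix u (s ++ t) ->
  infix u (s ++ z ++ t) \/ all [in A] u.
Proof.
move=> le es st /infix_cat_split[H|H|[v [w [E vs wt]]]].
- by left; exact: infix_catr.
- by left; apply/infix_catl/infix_catl.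
- right; move: le; rewrite E size_cat all_cat => le.
  by rewrite es ?st //; lia.
Qed.

(** The cut falls in the piece of at most one block; the pieces on either side of it are kept, so
    only that block needs the hypothesis on [b]. *)
Lemma chain_insert b N A z us s t :
    (forall u s t, size u <= N -> near_end N A s -> near_start N A t ->
       b u (s ++ t) -> b u (s ++ z ++ t)) ->
    all (fun u => size u <= N) us -> near_end N A s -> near_start N A t ->
  chain b us (s ++ t) -> chain b us (s ++ z ++ t).
Proof.
move=> bI; elim: us s => [//|u us IH] s /= /andP[le les] es st.
case=> x [y [/cat_eq_cat[][e [E1 E2]] bx cy]].
  exists x, (e ++ z ++ t); split=> //; first by rewrite E1 -!catA.
  apply: IH => //; last by rewrite -E2.
  by apply: near_end_suffix es; rewrite E1 suffix_suffix.
exists (s ++ z ++ e), y; split=> //; first by rewrite E2 -!catA.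
apply: bI => //; last by rewrite -E1.
by apply: near_start_prefix st; rewrite E2 prefix_prefix.
Qed.

Lemma chain_infix_insert N A z us s t :
    (forall u, size u <= N -> all [in A] u -> infix u z) ->
    all (fun u => size u <= N) us -> near_end N A s -> near_start N A t ->
  chain (@infix Sigma) us (s ++ t) -> chain (@infix Sigma) us (s ++ z ++ t).
Proof.
move=> zA; apply: chain_insert => u s' t' le es st.
case/(infix_insert z le es st) => // /(zA _ le) H.
by apply/infix_catl/infix_catr.
Qed.

Lemma chain_blk_insert l N A z us s t :
    (forall u, size u <= N -> all [in A] u -> blk l u z) ->
    all (fun u => size u <= N) us -> near_end N A s -> near_start N A t ->
  chain (blk l) us (s ++ t) -> chain (blk l) us (s ++ z ++ t).
Proof.
move=> zA; apply: chain_insert => u s' t' le es st.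
case/orP => [/(infix_insert z le es st)[H|/(zA _ le)]|H].
- by apply/orP; left.
- case/orP => H; apply/orP; [left|right].
    by apply/infix_catl/infix_catr.
  apply: subseq_trans H _; apply: subseq_trans (suffix_subseq s' _).
  exact: prefix_subseq.
- apply/orP; right; apply: subseq_trans H _.
  by apply: cat_subseq => //; apply: suffix_subseq.
Qed.

(** * Alphabets, rich words and the deletion of inserted words *)

Definition alph w : {set Sigma} := [set a in w].

(** A long product of words with the same alphabet. It has every word over [A] of length at most [m]
    as a subword, and in a DA monoid it absorbs words over [A]. *)
Definition rich A m r := exists ys : seq (seq Sigma),
  [/\ m <= size ys, r = flatten ys & {in ys, forall y, alph y = A}].

Lemma all_alph w : all [in alph w] w.
Proof. by apply/allP => a; rewrite inE. Qed.

Lemma alph_eq_all A w : alph w = A -> all [in A] w.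
Proof. by move=> <-; apply: all_alph. Qed.

Lemma all_flatten A (ys : seq (seq Sigma)) :
  {in ys, forall y, all [in A] y} -> all [in A] (flatten ys).
Proof.
by move=> H; apply/allP => a /flattenP[y /H/allP yA /yA].
Qed.

Lemma rich_all A m r : rich A m r -> all [in A] r.
Proof.
by case=> ys [_ -> H]; apply: all_flatten => y /H /alph_eq_all.
Qed.

Lemma rich_leq A m n r : m <= n -> rich A n r -> rich A m r.
Proof. by move=> le [ys [le' -> ?]]; exists ys; split=> //; lia. Qed.

Lemma rich_split A m n r : rich A (m + n) r ->
  exists r1 r2, [/\ r = r1 ++ r2, rich A m r1 & rich A n r2].
Proof.
case=> ys [le -> H]; exists (flatten (take m ys)), (flatten (drop m ys)).
rewrite -flatten_cat cat_take_drop; split=> //.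
  exists (take m ys); rewrite size_take; split=> //; first by case: ltnP; lia.
  by move=> y /mem_take/H.
exists (drop m ys); rewrite size_drop; split=> //; first by lia.
by move=> y /mem_drop/H.
Qed.

Lemma rich_subseq A m r v : rich A m r -> all [in A] v -> size v <= m ->
  subseq v r.
Proof.
case=> ys [le -> H] vA lev; have {lev le} : size v <= size ys by lia.
elim: ys v vA H => [|y ys IH] [|a v] //=.
  by rewrite sub0seq.
case/andP => aA vA H le; rewrite -cat1s; apply: cat_subseq.
  by rewrite sub1seq -(H y) ?mem_head // inE in aA *.
by apply: IH => // z zs; apply: H; rewrite in_cons zs orbT.
Qed.

Lemma rich_size A m r : A != finset.set0 -> rich A m r -> m <= size r.
Proof.
case/finset.set0Pn => a aA /(@rich_subseq _ _ _ (nseq m a)) H.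
by rewrite -(size_nseq m a); apply/size_subseq/H; rewrite ?size_nseq // all_nseq aA orbT.
Qed.

Lemma rich_near_end A m s r : A != finset.set0 -> rich A m r -> near_end m A (s ++ r).
Proof.
move=> A0 rr v vs le; rewrite suffix_catr_le in vs; last first.
  by apply: leq_trans le (rich_size A0 rr).
apply/allP => a av; apply: (allP (rich_all rr)).
by case/suffixP: vs => x ->; rewrite mem_cat av orbT.
Qed.

Lemma rich_near_start A m t r : A != finset.set0 -> rich A m r ->
  near_start m A (r ++ t).
Proof.
move=> A0 rr v vs le; rewrite prefix_catl_le in vs; last first.
  by apply: leq_trans le (rich_size A0 rr).
apply/allP => a av; apply: (allP (rich_all rr)).
by case/prefixP: vs => x ->; rewrite mem_cat av.
Qed.

Lemma near_start_leq A m n t : m <= n -> near_start n A t -> near_start m A t.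
Proof. by move=> le H v vt lev; apply: H => //; lia. Qed.

Lemma near_end_leq A m n t : m <= n -> near_end n A t -> near_end m A t.
Proof. by move=> le H v vt lev; apply: H => //; lia. Qed.

Lemma size_word_pow u l : size (word_pow u l) = l * size u.
Proof. by rewrite /word_pow; elim: l => //= l IH; rewrite size_cat IH. Qed.

Lemma all_word_pow A u l : all [in A] u -> all [in A] (word_pow u l).
Proof. by move=> H; apply: all_flatten => y /nseqP[->]. Qed.

Lemma rich_pow A N l r u : rich A (l * N) r -> all [in A] u -> size u <= N ->
  subseq (word_pow u l) r.
Proof.
move=> rr uA le; apply: rich_subseq rr _ _; first exact: all_word_pow.
by rewrite size_word_pow leq_mul2l le orbT.
Qed.

(** An occurrence of [u] inside [y], or across [y] and [t], is over [A], and then [u^l] is a subword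
    of [r]. An occurrence that leaves [s] is kept because [r] has the short prefixes of [y ++ t]; no
    such condition arises when [s] is empty. If [u^l] is a subword, the part of it read in [y] has
    length at most [C] and embeds into [r]. *)
Lemma blk_rich_swap l N C A u s y t r :
    A != finset.set0 -> size u <= N -> l * N <= C -> rich A C r ->
    all [in A] y -> near_start N A t ->
    (s = [::] \/ forall v, size v <= N -> prefix v (y ++ t) -> prefix v r) ->
  blk l u (s ++ y ++ t) -> blk l u (s ++ r ++ t).
Proof.
move=> A0 le leC rr yA st H.
have pow : all [in A] u -> blk l u (s ++ r ++ t).
  move=> uA; apply/orP; right; apply: subseq_trans (suffix_subseq s _).
  apply: subseq_trans (prefix_subseq _ _).
  exact: rich_pow (rich_leq leC rr) uA le.
case/orP.
  case/infix_cat_split => [I|/infix_cat_split[I|I|[v [w [E vs wt]]]]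
      |[v [w [E vs wt]]]].
  - by apply/orP; left; exact: infix_catr.
  - by apply: pow; apply/allP => a /(mem_infix I)/(allP yA).
  - by apply/orP; left; apply/infix_catl/infix_catl.
  - apply: pow; rewrite E all_cat (st w) //; last by move: le; rewrite E size_cat; lia.
    rewrite andbT; apply/allP => a av; apply: (allP yA).
    by case/suffixP: vs => x ->; rewrite mem_cat av orbT.
  - case: H => [s0|H].
      rewrite s0 suffixs0 in vs; move: E; rewrite (eqP vs) /= => uw.
      move: wt; rewrite -uw => /prefixW/infix_cat_split[I|I|[v' [w' [E' vs' wt']]]].
      - by apply: pow; apply/allP => a /(mem_infix I)/(allP yA).
      - by apply/orP; left; apply/infix_catl/infix_catl.
      - apply: pow; rewrite E' all_cat (st w') //; last by move: le; rewrite E' size_cat; lia.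
        rewrite andbT; apply/allP => a av; apply: (allP yA).
        by case/suffixP: vs' => x ->; rewrite mem_cat av orbT.
    have {}H : prefix w r by apply: H => //; move: le; rewrite E size_cat; lia.
    apply/orP; left; rewrite E catA; apply: infix_catr.
    case/suffixP: vs => x ->; case/prefixP: H => x' ->.
    by rewrite -catA; apply: infix_catl; rewrite catA prefix_infix.
case/subseq_cat_split => p1 [p' [E S1 /subseq_cat_split[p2 [p3 [E' S2 S3]]]]].
apply/orP; right; rewrite E E'; apply: cat_subseq => //; apply: cat_subseq => //.
apply: rich_subseq rr _ _.
  by apply/allP => a /(mem_subseq S2)/(allP yA).
have : size p2 <= size (word_pow u l) by rewrite E E' !size_cat addnCA leq_addr.
rewrite size_word_pow => le2; apply: leq_trans le2 _; apply: leq_trans leC.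
by rewrite leq_mul2l le orbT.
Qed.

(** When a boundary between two pieces falls in [y], the current block receives [C] factors of [r]
    and the later blocks share the rest, whence [size us * C]. The remaining word then begins inside
    [y], which is the case of an empty [s]. *)
Lemma chain_blk_rich_swap l N C A us s y t r m :
    A != finset.set0 -> all (fun u => size u <= N) us -> l * N <= C -> N <= C ->
    size us * C <= m -> rich A m r -> all [in A] y -> near_start N A t ->
    (s = [::] \/ forall v, size v <= N -> prefix v (y ++ t) -> prefix v r) ->
  chain (blk l) us (s ++ y ++ t) -> chain (blk l) us (s ++ r ++ t).
Proof.
move=> A0 + leC leNC; elim: us s y m r => [//|u us IH] s y m r /= /andP[le les].
rewrite mulSn => lem rr yA st H [x [w [/cat_eq_cat[][e [E1 E2]] bx cw]]].
  exists x, (e ++ r ++ t); split=> //; first by rewrite E1 -catA.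
  apply: (IH _ y m) => //; [by lia| |by rewrite -E2].
  case: H => H; last by right.
  left; apply/nilP; rewrite /nilp -leqn0.
  by have /= := leq_addl (size x) (size e); rewrite -size_cat -E1 H.
case/esym/cat_eq_cat: E2 => [][f [E2 E3]].
  have [r1 [r2 [Er rr1 _]]] : exists r1 r2, [/\ r = r1 ++ r2, rich A C r1
      & rich A (size us * C) r2] by apply: rich_split; apply: (rich_leq _ rr).
  exists (s ++ r ++ f), w; split=> //; first by rewrite E3 -!catA.
  apply: (blk_rich_swap (A := A) (N := N) (C := C) (y := y)) => //.
  - by apply: (rich_leq _ rr); lia.
  - by apply: near_start_prefix st; rewrite E3 prefix_prefix.
  - case: H => [|H]; [by left|right=> v lev pv]; apply: H => //.
    by apply: prefix_trans pv _; rewrite E3 catA prefix_prefix.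
  - by rewrite -E2 -E1.
have [r1 [r2 [Er rr1 rr2]]] : exists r1 r2, [/\ r = r1 ++ r2, rich A C r1
    & rich A (size us * C) r2] by apply: rich_split; apply: (rich_leq _ rr).
exists (s ++ r1), (r2 ++ t); split; first by rewrite Er -!catA.
  rewrite -[r1]cats0; apply: (blk_rich_swap (A := A) (N := N) (C := C) (y := e)) => //.
  - by apply/allP => a ae; apply: (allP yA); rewrite E2 mem_cat ae.
  - by move=> v; rewrite prefixs0 => /eqP ->.
  - case: H => [|H]; [by left|right=> v lev].
    rewrite cats0 => pv; rewrite -(@prefix_catl_le _ _ r1 r2) -?Er.
      by apply: H => //; apply: prefix_trans pv _; rewrite E2 -catA prefix_prefix.
    exact: leq_trans lev (leq_trans leNC (rich_size A0 rr1)).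
  - by rewrite cats0 -E1.
rewrite -[_ ++ t]cat0s; apply: (IH _ f (size us * C)) => //.
- by apply/allP => a af; apply: (allP yA); rewrite E2 mem_cat af orbT.
- by left.
- by rewrite cat0s -E3.
Qed.

(** Deletion is the swap of [s1 ++ z] for [s1], which is itself rich and has the same short
    prefixes. *)
Lemma chain_blk_delete l N C A us s s1 z t m :
    A != finset.set0 -> all (fun u => size u <= N) us -> l * N <= C -> N <= C ->
    size us * C <= m -> N <= m -> rich A m s1 -> all [in A] z ->
    near_start N A t ->
  chain (blk l) us (s ++ s1 ++ z ++ t) -> chain (blk l) us (s ++ s1 ++ t).
Proof.
move=> A0 les leC leNC lem leNm rr zA st; rewrite (catA s1).
apply: (chain_blk_rich_swap (A := A) (N := N) (C := C) (m := m)) => //.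
  by rewrite all_cat (rich_all rr).
right=> v lev; rewrite -catA prefix_catl_le //.
exact: leq_trans lev (leq_trans leNm (rich_size A0 rr)).
Qed.

Lemma chain_sub b b' us w : (forall u w, b u w -> b' u w) ->
  chain b us w -> chain b' us w.
Proof.
move=> sub; elim: us w => [//|u us IH] w /= [x [y [-> bx /IH cy]]].
by exists x, y; split=> //; apply: sub.
Qed.

Lemma subseq_word_pow u l l' : l <= l' -> subseq (word_pow u l) (word_pow u l').
Proof.
rewrite /word_pow => le; rewrite -(subnKC le) nseqD flatten_cat.
exact: prefix_subseq.
Qed.

Lemma blk_leq l l' u w : l <= l' -> blk l' u w -> blk l u w.
Proof.
move=> le /orP[I|S]; apply/orP; [by left|right].
exact: subseq_trans (subseq_word_pow u le) S.
Qed.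

Lemma chain_blk_leq l l' us w : l <= l' -> chain (blk l') us w ->
  chain (blk l) us w.
Proof. by move=> le; apply: chain_sub => u x; apply: blk_leq. Qed.

End Chains.

(** * The variety DA *)

Local Open Scope classical_set_scope.

(** Pigeonhole, with [c] the length of a list of all elements. *)
Lemma finite_repeat (T : choiceType) : finite_set [set: T] ->
  exists c, forall f : nat -> T, exists i j, [/\ i < j, j <= c & f i = f j].
Proof.
case/finite_seqP => s sT; exists (size s) => f.
have sP x : x \in s by have : [set: T] x by []; rewrite sT.
have : ~~ uniq (map f (iota 0 (size s).+1)).
  apply/negP => /uniq_leq_size/(_ (fun x _ => sP x)).
  by rewrite size_map size_iota ltnn.
case/(uniqPn (f 0)) => i [j []]; rewrite size_map size_iota => ij js.
have is_ := ltn_trans ij js.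
by rewrite !(nth_map 0) ?size_iota // !nth_iota // !add0n; exists i, j.
Qed.

Section DAPower.
Local Open Scope group_scope.
Variables (M : monoidType) (n : nat).
Hypothesis n_gt1 : 1 < n.
Hypothesis DAn : forall x y : M, (x * y) ^+ n * x * (x * y) ^+ n = (x * y) ^+ n.
Implicit Types (x y z p q m e : M).

Lemma da_pow_idem x : x ^+ n * x ^+ n = x ^+ n.
Proof. by have := DAn 1 x; rewrite !mul1g mulg1. Qed.

Lemma idem_pow e k : 0 < k -> e * e = e -> e ^+ k = e.
Proof.
case: k => // k _ ee; elim: k => [|k IH]; first by rewrite expg1.
by rewrite expgS IH.
Qed.

Lemma da_idem_left e x y : e * e = e -> e = x * y -> e * x * e = e.
Proof.
by move=> ee exy; have := DAn x y; rewrite -exy idem_pow //; lia.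
Qed.

(** The conjugate [f = y e x] of [e] equals every power of [y x] with exponent at least 2. The
    hypothesis on [y] and [x] then reads [f y f = f], which is carried back to [e]. *)
Lemma da_idem_right e x y : e * e = e -> e = x * y -> e * y * e = e.
Proof.
move=> ee exy; set f := y * e * x.
have yxf : y * x * f = f by rewrite /f -!mulgA (mulgA x y) -exy (mulgA e) ee.
have fE : (y * x) ^+ n = f.
  have yx2 : (y * x) * (y * x) = f by rewrite /f exy !mulgA.
  have -> : n = (n - 2).+2 by lia.
  by elim: (n - 2) => [|k IH]; rewrite expgS ?expg1 ?IH.
have ff : f * y * f = f by have := DAn y x; rewrite fE.
have eE : e = x * f * y by rewrite /f !mulgA -exy -(mulgA _ x y) -exy !ee.
have -> : e * y * e = x * (f * y * (y * x * f)) * y.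
  by rewrite [in LHS]eE !mulgA.
by rewrite yxf ff -eE.
Qed.

(** The left case gives [e = (e p) (m e)], to which the right case applies. *)
Lemma da_idem_mid e p m q : e * e = e -> e = p * m * q -> e * m * e = e.
Proof.
move=> ee epmq.
have H1 : e = (e * p) * (m * e).
  by rewrite mulgA -(mulgA e p m) (da_idem_left ee epmq).
have := da_idem_right ee H1.
by rewrite -!mulgA ee.
Qed.

(** The element [f = q e] is idempotent and has [p] as a factor, so [f p f = f]; moreover
    [e (p q) e = e f p f]. *)
Lemma da_idem_mul e p q : e * e = e -> e * p * e = e -> e * q * e = e ->
  e * (p * q) * e = e.
Proof.
move=> ee ep eq; set f := q * e.
have ff : f * f = f by rewrite /f -mulgA (mulgA e) eq.
have fE : f = f * p * e by rewrite /f -!mulgA (mulgA e) ep.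
transitivity (e * (f * p * f)); first by rewrite /f !mulgA eq.
by rewrite (da_idem_mid ff fE) /f mulgA.
Qed.

Section Morphism.
Variables (Sigma : finType) (mu : seq Sigma -> M).
Hypothesis mu1 : mu [::] = 1.
Hypothesis muM : forall u v, mu (u ++ v) = mu u * mu v.
Implicit Types (A : {set Sigma}) (u v w s t : seq Sigma).

(** Each letter of [w] is a factor of the idempotent [mu u ^+ n], hence absorbed by it, and absorbed
    elements are closed under products. *)
Lemma da_alph_absorb u w : all [in alph u] w ->
  mu u ^+ n * mu w * mu u ^+ n = mu u ^+ n.
Proof.
have ee := da_pow_idem (mu u); elim: w => [|a w IH] /=.
  by rewrite mu1 mulg1.
case/andP; rewrite inE => au /IH {}IH; rewrite -cat1s muM.
apply: da_idem_mul => //; case/splitPr: au ee {IH} => p q ee.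
apply: (@da_idem_mid _ (mu p) _ (mu q * mu (p ++ a :: q) ^+ n.-1)) => //.
rewrite mulgA -(mulgA (mu p)) -!muM cat1s -expgS; congr (_ ^+ _); lia.
Qed.

Lemma morph_pow u k : mu (word_pow u k) = mu u ^+ k.
Proof. by elim: k => [|k IH] //; rewrite expgS -IH -muM. Qed.

(** Expanding the power of [v] to [v^n u^n v^n] puts [w v^n] between two powers of [u], which absorb
    it. *)
Lemma da_full_swap A u v w : alph u = A -> alph v = A -> all [in A] w ->
  mu u ^+ n * mu w * mu v ^+ n = mu u ^+ n * mu v ^+ n.
Proof.
move=> uA vA wA.
have vE : mu v ^+ n = mu v ^+ n * mu u ^+ n * mu v ^+ n.
  by rewrite -[in X in _ * X * _]morph_pow da_alph_absorb // vA all_word_pow // alph_eq_all.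
rewrite [X in _ * _ * X]vE; have H : mu u ^+ n * mu (w ++ word_pow v n) * mu u ^+ n = mu u ^+ n.
  by apply: da_alph_absorb; rewrite uA all_cat wA all_word_pow // alph_eq_all.
by move: H; rewrite muM morph_pow !mulgA => ->.
Qed.

(** By pigeonhole on the prefix products, [s = a b] where [mu a] is fixed by right multiplication
    with a word [x] of full alphabet; symmetrically [t = b' d] with a word [y]. Powers of [x] and
    [y] can thus be created next to [a] and [d], and they absorb whatever lies between. *)
Lemma rich_insert_value A c s t w :
    (forall f : nat -> M, exists i j, [/\ i < j, j <= c & f i = f j]) ->
    rich A c s -> rich A c t -> all [in A] w ->
  mu (s ++ w ++ t) = mu (s ++ t).
Proof.
move=> rep [ys [szs -> yA]] [zs [szt -> zA]] wA.
have full (xs : seq (seq Sigma)) i j : i < j -> j <= size xs ->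
    {in xs, forall v, alph v = A} -> alph (flatten (drop i (take j xs))) = A.
  move=> ij js xA; apply/setP => a; rewrite inE; apply/flattenP/idP.
    by case=> x /mem_drop/mem_take/xA <- ax; rewrite inE.
  have : size (drop i (take j xs)) != 0 by rewrite size_drop size_takel //; lia.
  case E: (drop i (take j xs)) => [|x xs'] // _ aA.
  exists x; rewrite ?mem_head //.
  have /mem_drop/mem_take/xA : x \in drop i (take j xs) by rewrite E mem_head.
  by move/setP/(_ a); rewrite aA inE.
have loopl (p x : M) k : p = p * x -> p = p * x ^+ k.
  by move=> E; elim: k => [|k IH]; rewrite ?mulg1 // expgS mulgA -E.
have loopr (p x : M) k : p = x * p -> p = x ^+ k * p.
  by move=> E; elim: k => [|k IH]; rewrite ?mul1g // expgSr -mulgA -E.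
have [a [x [b [sE xA bA pE]]]] : exists (a x b : seq Sigma), [/\ flatten ys = a ++ b,
    alph x = A, all [in A] b & mu a = mu a * mu x].
  case: (rep (fun i => mu (flatten (take i ys)))) => i [j [ij jc E]].
  exists (flatten (take i ys)), (flatten (drop i (take j ys))), (flatten (drop i ys)).
  split; first by rewrite -flatten_cat cat_take_drop.
  - by apply: full => //; lia.
  - by apply: all_flatten => y /mem_drop/yA/alph_eq_all.
  - rewrite [LHS]E -muM -flatten_cat; congr (mu (flatten _)).
    by rewrite -[LHS](cat_take_drop i) take_takel // ltnW.
have [d [y [b' [tE yA' bA' qE]]]] : exists (d y b' : seq Sigma), [/\ flatten zs = b' ++ d,
    alph y = A, all [in A] b' & mu d = mu y * mu d].
  case: (rep (fun i => mu (flatten (drop i zs)))) => i [j [ij jc E]].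
  exists (flatten (drop j zs)), (flatten (drop i (take j zs))), (flatten (take j zs)).
  split; first by rewrite -flatten_cat cat_take_drop.
  - by apply: full => //; lia.
  - by apply: all_flatten => z /mem_take/zA/alph_eq_all.
  - rewrite -[LHS]E -muM -flatten_cat; congr (mu (flatten _)).
    rewrite -[in LHS](cat_take_drop j zs) drop_cat size_takel; last by lia.
    by rewrite ij.
have K v : all [in A] v -> mu (a ++ v ++ d) = mu a * (mu x ^+ n * mu y ^+ n) * mu d.
  move=> vA; rewrite !muM {1}(loopl _ _ n pE) {1}(loopr _ _ n qE).
  by rewrite -(da_full_swap xA yA' vA) !mulgA.
rewrite sE tE -!catA (catA w) (catA b) K ?(catA b b') ?K //.
  by rewrite all_cat bA.
by rewrite !all_cat bA wA.
Qed.

End Morphism.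
End DAPower.

(** * DA with all large exponents *)

Section DAEventually.
Local Open Scope group_scope.
Variable M : monoidType.
Implicit Types x y : M.

Definition eventually_DA := exists N, forall n, N <= n -> forall x y,
  (x * y) ^+ n * x * (x * y) ^+ n = (x * y) ^+ n.

(** The case [x = y] of the identity makes [M] aperiodic, so powers are constant from [w] on. *)
Lemma DA_eventually : DA M -> eventually_DA.
Proof.
case=> fin [w [[w0 idem] _] H]; exists w => n le x y.
have ww (z : M) : z ^+ w * z ^+ w = z ^+ w.
  by rewrite -expgnDr addnn -mul2n -idem.
have per (z : M) : z ^+ w.+1 = z ^+ w.
  have E : z ^+ w = z ^+ w * z * z ^+ w.
    by have := H z z; rewrite -expg2 -expgnA -idem.
  by rewrite [RHS]E -mulgA -expgS !expgSr mulgA ww.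
have perD (z : M) k : z ^+ (w + k) = z ^+ w.
  by elim: k => [|k IH]; rewrite ?addn0 // addnS expgSr IH -expgSr per.
by rewrite -(subnKC le) !perD -H.
Qed.

Lemma eventually_DA_DA : finite_set [set: M] -> eventually_DA -> DA M.
Proof.
move=> fin [N H]; split=> //.
have idem n : N <= n -> forall x, x ^+ n * x ^+ n = x ^+ n.
  by move=> le x; have := H n le 1 x; rewrite mul1g mulg1.
have ex : exists n, (0 < n) && `[< forall x, x ^+ n = x ^+ (2 * n) >].
  exists N.+1; apply/asboolP => x.
  by rewrite mul2n -addnn expgnDr idem.
case: (ex_minnP ex) => w /andP[w0 /asboolP wE] wmin; exists w.
  split=> // n [n0 nE]; apply: wmin; rewrite n0; exact/asboolP.
move=> x y.
(* The idempotent power may lie below [N]; it is replaced by a multiple above [N]. *)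
have wN (z : M) : z ^+ w = z ^+ (w * N.+1).
  elim: (N) => [|k IH]; first by rewrite muln1.
  by rewrite mulnS expgnDr -IH -expgnDr addnn -mul2n -wE.
by rewrite wN H // (leq_trans (leqnSn N)) // leq_pmull.
Qed.

End DAEventually.

(** * Saturation by insertions *)

Lemma count_sub_eq (T : eqType) (p q : pred T) (s : seq T) :
    (forall x, p x -> q x) -> count p s = count q s ->
  {in s, forall x, q x -> p x}.
Proof.
move=> pq; elim: s => //= a s IH E.
have le := sub_count pq s; have := pq a; case: (boolP (p a)) E => pa.
  move=> E /(_ isT) qa; rewrite qa in E; case: E => /IH {}IH x.
  by rewrite in_cons => /orP[/eqP ->|/IH].
case: (boolP (q a)) => qa E _; first by lia.
move=> x; rewrite in_cons => /orP[/eqP ->|/IH]; first by rewrite (negbTE qa).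
by apply; lia.
Qed.

Lemma nonincreasing_stationary (g : nat -> nat) B :
  (forall j, g j.+1 <= g j) -> g 0 <= B -> exists2 j, j <= B & g j.+1 = g j.
Proof.
elim: B g => [|B IH] g dec g0.
  by exists 0 => //; have := dec 0; lia.
have [E|ne] := eqVneq (g 1) (g 0); first by exists 0.
have [||j le E] := IH (fun j => g j.+1); [by move=> j|by have := dec 0; lia|].
by exists j.+1.
Qed.

Section Insertions.
Variables (Sigma : finType) (N : nat).
Implicit Types (A : {set Sigma}) (u v w x y z s t r : seq Sigma).
Implicit Types (us : seq (seq Sigma)).

(** The word to be inserted: it serves all short factors over [A] at once. *)
Definition all_words A := flatten (words_upto (enum A) N).

Lemma infix_all_words A u : size u <= N -> all [in A] u -> infix u (all_words A).
Proof.
move=> le uA; rewrite /all_words.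
have : u \in words_upto (enum A) N.
  by rewrite mem_words_upto le; apply/allP => a /(allP uA); rewrite mem_enum.
elim: (words_upto _ _) => //= x xs IH; rewrite in_cons.
by case/orP => [/eqP ->|/IH]; [apply: infix_catr; apply: infix_refl | apply: infix_catl].
Qed.

Lemma all_all_words A : all [in A] (all_words A).
Proof.
apply: all_flatten => y; rewrite mem_words_upto => /andP[_ /allP H].
by apply/allP => a /H; rewrite /= mem_enum.
Qed.

Definition ins_step m w w' := exists A s s1 t1 t,
  [/\ A != finset.set0, rich A m s1, rich A m t1, w = s ++ s1 ++ t1 ++ t
    & w' = s ++ s1 ++ all_words A ++ t1 ++ t].

Inductive ins m w : seq Sigma -> Prop :=
| ins_refl : ins m w w
| ins_next w1 w2 : ins_step m w w1 -> ins m w1 w2 -> ins m w w2.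

Lemma ins_trans m w1 w2 w3 : ins m w1 w2 -> ins m w2 w3 -> ins m w1 w3.
Proof. by elim=> // u v w uv _ IH /IH; apply: ins_next uv. Qed.

Lemma ins_ctx m p q w w' : ins m w w' -> ins m (p ++ w ++ q) (p ++ w' ++ q).
Proof.
elim=> [x|x y z [A [s [s1 [t1 [t [A0 rs rt -> ->]]]]]] _ IH]; first exact: ins_refl.
apply: ins_next IH; exists A, (p ++ s), s1, t1, (t ++ q).
by split=> //; rewrite -!catA.
Qed.

Lemma ins_cat m x x' y y' : ins m x x' -> ins m y y' -> ins m (x ++ y) (x' ++ y').
Proof.
move=> /(@ins_ctx _ [::] y) H1 /(@ins_ctx _ x' [::]) H2.
by apply: ins_trans H1 _; rewrite !cats0 in H2.
Qed.

Lemma ins_ind_rel m (R : seq Sigma -> seq Sigma -> Prop) :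
  (forall w, R w w) -> (forall u v w, R u v -> R v w -> R u w) ->
  (forall w w', ins_step m w w' -> R w w') -> forall w w', ins m w w' -> R w w'.
Proof. by move=> r t s w w'; elim=> // u v x /s uv _; apply: t uv. Qed.

Lemma ins_chain_infix m us w w' : N <= m -> all (fun u => size u <= N) us ->
  ins m w w' -> chain (@infix Sigma) us w -> chain (@infix Sigma) us w'.
Proof.
move=> le les.
apply: (ins_ind_rel (R := fun w w' => chain (@infix Sigma) us w -> chain (@infix Sigma) us w')).
- by [].
- by move=> u v x uv vx /uv /vx.
move=> _ _ [A [s [s1 [t1 [t [A0 rs rt -> ->]]]]]].
rewrite !(catA s); apply: (chain_infix_insert (N := N) (A := A)) => //.
- exact: infix_all_words.
- exact: near_end_leq le (rich_near_end A0 rs).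
- exact: near_start_leq le (rich_near_start A0 rt).
Qed.

Lemma ins_chain_blk m l us w w' : N <= m -> all (fun u => size u <= N) us ->
  ins m w w' -> chain (blk l) us w -> chain (blk l) us w'.
Proof.
move=> le les.
apply: (ins_ind_rel (R := fun w w' => chain (blk l) us w -> chain (blk l) us w')).
- by [].
- by move=> u v x uv vx /uv /vx.
move=> _ _ [A [s [s1 [t1 [t [A0 rs rt -> ->]]]]]].
rewrite !(catA s); apply: (chain_blk_insert (N := N) (A := A)) => //.
- by move=> u leu uA; apply/orP; left; exact: infix_all_words.
- exact: near_end_leq le (rich_near_end A0 rs).
- exact: near_start_leq le (rich_near_start A0 rt).
Qed.

(** Insertions create no new threshold test when [m] is large compared with [l], since each can be
    deleted again. The constant [l.+1 * N] bounds both [l * N] and [N]. *)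
Lemma ins_chain_blk_inv m l us w w' : N <= m -> size us * (l.+1 * N) <= m ->
    all (fun u => size u <= N) us ->
  ins m w w' -> chain (blk l) us w' -> chain (blk l) us w.
Proof.
move=> le lem les.
apply: (ins_ind_rel (R := fun w w' => chain (blk l) us w' -> chain (blk l) us w)).
- by [].
- by move=> u v x uv vx /vx /uv.
move=> _ _ [A [s [s1 [t1 [t [A0 rs rt -> ->]]]]]].
apply: (chain_blk_delete (N := N) (C := l.+1 * N) (m := m) A0) => //.
- by rewrite mulSn leq_addl.
- by rewrite mulSn leq_addr.
- exact: all_all_words.
- exact: near_start_leq le (rich_near_start A0 rt).
Qed.

Lemma ins_prefix m v w w' : N <= m -> size v <= N -> ins m w w' ->
  prefix v w = prefix v w'.
Proof.
move=> le lev; apply: (ins_ind_rel (R := fun w w' => prefix v w = prefix v w')).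
- by [].
- by move=> x y z ->.
move=> _ _ [A [s [s1 [t1 [t [A0 rs rt -> ->]]]]]].
have lev' : size v <= size (s ++ s1).
  rewrite size_cat.
  exact: leq_trans (leq_trans lev le) (leq_trans (rich_size A0 rs) (leq_addl _ _)).
by rewrite !(catA s) !(prefix_catl_le _ lev').
Qed.

Lemma ins_suffix m v w w' : N <= m -> size v <= N -> ins m w w' ->
  suffix v w = suffix v w'.
Proof.
move=> le lev; apply: (ins_ind_rel (R := fun w w' => suffix v w = suffix v w')).
- by [].
- by move=> x y z ->.
move=> _ _ [A [s [s1 [t1 [t [A0 rs rt -> ->]]]]]].
have lev' : size v <= size (t1 ++ t).
  rewrite size_cat.
  exact: leq_trans (leq_trans lev le) (leq_trans (rich_size A0 rt) (leq_addr _ _)).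
by rewrite (catA s) (catA s1 (all_words A)) (catA s (s1 ++ _)) !(suffix_catr_le _ lev').
Qed.

Lemma subseq_pow_split u l w : subseq (word_pow u l) w ->
  exists xs r, [/\ size xs = l, w = flatten xs ++ r
    & {in xs, forall x, subseq u x}].
Proof.
rewrite /word_pow; elim: l w => [|l IH] w /=.
  by exists [::], w.
case/cat_subseq_split => x [y [-> ux /IH[xs [r [sz -> H]]]]].
exists (x :: xs), r; split; rewrite /= ?sz ?catA // => z.
by rewrite in_cons => /orP[/eqP ->|/H].
Qed.

(* Among [M ^ c] words over at most [c] letters, [M] consecutive groups have the
   same alphabet: cut into [M] groups; either all groups use all the letters, or
   one of them misses a letter. *)
Lemma equal_alph_groups u M c (xs : seq (seq Sigma)) :
    0 < M -> u <> [::] -> size xs = M ^ c -> #|alph (flatten xs)| <= c ->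
    {in xs, forall x, subseq u x} ->
  exists A s ys t, [/\ flatten xs = s ++ flatten ys ++ t, size ys = M,
    {in ys, forall y, alph y = A} & all [in A] u].
Proof.
move=> M0 u0; elim: c xs => [|c IH] xs sz le ux.
  case: xs sz le ux => [|x [|]] //= _; rewrite cats0 leqn0 cards_eq0 => /eqP a0.
  move/(_ x (mem_head _ _))/mem_subseq; case: u u0 => // b u _ /(_ b (mem_head _ _)) bx.
  by have := finset.in_set0 b; rewrite -a0 inE bx.
set A := alph (flatten xs).
set g := reshape (nseq M (M ^ c)) xs.
have sz' : sumn (nseq M (M ^ c)) = size xs by rewrite sumn_nseq sz expnS mulnC.
have gE : flatten g = xs by rewrite reshapeKr // sz'.
have sg : shape g = nseq M (M ^ c) by rewrite reshapeKl // sz'.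
have szg : size g = M by rewrite -(size_map size) -/(shape g) sg size_nseq.
have gx h : h \in g -> {subset h <= xs}.
  by move=> hg x xh; rewrite -gE; apply/flattenP; exists h.
have gA h : h \in g -> alph (flatten h) \subset A.
  move=> hg; apply/fintype.subsetP => a; rewrite !inE => /flattenP[x xh ax].
  by apply/flattenP; exists x => //; apply: gx xh.
have [all_full|] := boolP (all (fun h => alph (flatten h) == A) g).
  exists A, [::], (map flatten g), [::]; split.
  - by rewrite cats0 /= -{1}gE; elim: (g) => //= h g' <-; rewrite flatten_cat.
  - by rewrite size_map.
  - by move=> _ /mapP[h hg ->]; apply/eqP/(allP all_full).
  - have [x xxs] : exists x, x \in xs.
      case: (xs) sz => [|x xs' _]; last by exists x; rewrite mem_head.
      by move=> /eqP; rewrite /= eq_sym expn_eq0 -leqn0 leqNgt M0.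
    apply/allP => a /(mem_subseq (ux x xxs)) ax; rewrite inE.
    by apply/flattenP; exists x.
case/allPn => h hg neA.
have [|||B [s [ys [t [E szy yB uB]]]]] := IH h.
- by apply/eqP; move: (map_f size hg); rewrite -/(shape g) sg => /nseqP[->].
- have : alph (flatten h) \proper A.
    by rewrite finset.properEneq neA gA.
  by move/proper_card => lt; rewrite -ltnS; apply: leq_trans lt le.
- by move=> x /(gx _ hg)/ux.
case/splitPr: hg gE {gx gA sg szg} => g1 g2 gE.
exists B, (flatten (flatten g1) ++ s), ys, (t ++ flatten (flatten g2)); split=> //.
by rewrite -gE !flatten_cat /= E -!catA.
Qed.

(** The exponent yields [2 * m.+1] consecutive groups with a common alphabet containing the letters
    of [u]; the insertion is made halfway, with [m.+1] groups on each side. *)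
Lemma ins_pow m u w : size u <= N ->
    subseq (word_pow u ((2 * m.+1) ^ #|Sigma|)) w ->
  exists2 w', ins m.+1 w w' & infix u w'.
Proof.
move=> le; have [->|/eqP u0] := eqVneq u [::].
  by exists w; [exact: ins_refl | rewrite infix0s].
case/subseq_pow_split => xs [r [sz -> ux]].
have [A [s [ys [t [-> szy yA uA]]]]] :=
  @equal_alph_groups u (2 * m.+1) #|Sigma| xs isT u0 sz (max_card _) ux.
rewrite mul2n -addnn in szy.
have [|s1 [t1 [-> rs rt]]] := @rich_split _ A m.+1 m.+1 (flatten ys).
  by exists ys; rewrite szy.
exists (s ++ s1 ++ all_words A ++ t1 ++ t ++ r); last first.
  by apply/infix_catl/infix_catl/infix_catr/infix_all_words.
apply: ins_next (ins_refl _ _); exists A, s, s1, t1, (t ++ r).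
rewrite -!catA; split=> //; case: u u0 uA {le ux} => // a u _ /andP[aA _].
by apply/finset.set0Pn; exists a.
Qed.

Lemma ins_chain m l us w : (2 * m.+1) ^ #|Sigma| <= l ->
    all (fun u => size u <= N) us -> chain (blk l) us w ->
  exists2 w', ins m.+1 w w' & chain (@infix Sigma) us w'.
Proof.
move=> lel; elim: us w => [|u us IH] w /=; first by exists w; [exact: ins_refl|].
case/andP => le /IH{}IH [x [y [-> bx /IH[y' yy' cy']]]].
have [x' xx' ux'] : exists2 x', ins m.+1 x x' & infix u x'.
  case/orP: bx => [ux|/(subseq_trans (subseq_word_pow u lel))].
    by exists x => //; exact: ins_refl.
  exact: ins_pow.
by exists (x' ++ y'); [exact: ins_cat | exists x', y'].
Qed.

(** The tests are treated one at a time: insertions made for one preserve the block tests of the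
    others and the marked tests already reached. *)
Lemma ins_chains m l (Us : seq (seq (seq Sigma))) w :
    N <= m.+1 -> (2 * m.+1) ^ #|Sigma| <= l ->
    {in Us, forall us, all (fun u => size u <= N) us /\ chain (blk l) us w} ->
  exists2 w', ins m.+1 w w' & {in Us, forall us, chain (@infix Sigma) us w'}.
Proof.
move=> le lel; elim: Us => [|us Us IH] H; first by exists w; [exact: ins_refl|].
have [|w1 ww1 H1] := IH.
  by move=> vs vU; apply: H; rewrite in_cons vU orbT.
have [les cus] := H us (mem_head _ _).
have [w2 ww2 H2] := ins_chain lel les (ins_chain_blk le les ww1 cus).
exists w2; first exact: ins_trans ww1 ww2.
move=> vs; rewrite in_cons => /orP[/eqP -> //|vU].
apply: ins_chain_infix le _ ww2 (H1 vs vU).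
by case: (H vs); rewrite // in_cons vU orbT.
Qed.

Variables K c : nat.

Definition small us := (size us <= K) && all (fun u => size u <= N) us.

Definition smalls := words_upto (words_upto (enum Sigma) N) K.

Lemma mem_smalls us : (us \in smalls) = small us.
Proof.
rewrite /smalls mem_words_upto /small; congr (_ && _); apply: eq_all => u /=.
rewrite mem_words_upto andb_idr // => _.
by apply/allP => a _; rewrite /= mem_enum.
Qed.

(** One summand for each demand on insertions: reversibility for tests of threshold [l], unchanged
    short prefixes and suffixes, unchanged value in the monoid. *)
Definition ins_radius l := K * (l.+1 * N) + N + c.

(** A power that is a subword at this threshold leaves room for an insertion reversible at threshold
    [l]. *)
Definition next_threshold l := l + (2 * (ins_radius l).+1) ^ #|Sigma|.

Definition threshold j := iter j next_threshold 1.

Definition max_threshold := threshold (size smalls).+1.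

(** The number of small tests satisfied by [u] does not increase along the thresholds and is at most
    [size smalls], so it agrees at two consecutive ones. Saturation turns each test satisfied there
    into a marked test, and reversibility at the lower threshold excludes any other. *)
Lemma threshold_saturation u v :
    (forall l us, l <= max_threshold -> small us ->
       chain (blk l) us u <-> chain (blk l) us v) ->
  exists m u' v', [/\ c <= m /\ N <= m, ins m u u', ins m v v' & forall us, small us ->
     chain (@infix Sigma) us u' <-> chain (@infix Sigma) us v'].
Proof.
move=> uv; pose P w j us := `[< chain (blk (threshold j)) us w >].
have thS j : threshold j <= threshold j.+1 by rewrite /= leq_addr.
have PS w j us : P w j.+1 us -> P w j us.
  by move=> /asboolP H; apply/asboolP; apply: chain_blk_leq (thS j) H.
have [|j le jE] := @nonincreasing_stationary (fun j => count (P u j) smalls)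
    (size smalls) _ (count_size _ _).
  by move=> j; apply: sub_count => us; apply: PS.
have thm i : i <= (size smalls).+1 -> threshold i <= max_threshold.
  by move=> le'; apply: (homo_leq (@leqnn) leq_trans thS).
have uj us : small us -> chain (blk (threshold j)) us u ->
    chain (blk (threshold j.+1)) us u.
  move=> sus /asboolP H; apply/asboolP; apply: (count_sub_eq (@PS u j) jE) => //.
  by rewrite mem_smalls.
(* The index [j] was chosen for [u] alone; the agreement of [u] and [v] on tests transfers its
   property to [v]. *)
have vj us : small us -> chain (blk (threshold j)) us v ->
    chain (blk (threshold j.+1)) us v.
  move=> sus /(uv _ _ _ sus) H; apply/(uv _ _ _ sus); first by apply: thm; lia.
  by apply: uj => //; apply: H; apply: thm; lia.
pose m := (ins_radius (threshold j)).+1.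
have sat w : (forall us, small us -> chain (blk (threshold j)) us w ->
      chain (blk (threshold j.+1)) us w) ->
    exists2 w', ins m w w' & forall us, small us ->
      chain (@infix Sigma) us w' <-> chain (blk (threshold j)) us w.
  move=> wj; have [|||w' ww' H] := @ins_chains (ins_radius (threshold j))
      (threshold j.+1) [seq us <- smalls | `[< chain (blk (threshold j)) us w >]] w.
  - by rewrite /ins_radius; lia.
  - by rewrite /= leq_addl.
  - move=> us; rewrite mem_filter mem_smalls => /andP[/asboolP cus sus].
    by split; [case/andP: sus | exact: wj].
  exists w' => // us sus; split=> [cus|cus].
    have [szK les] := andP sus.
    apply: (@ins_chain_blk_inv m _ us w w') => //.
    - by rewrite /m /ins_radius; lia.
    - rewrite /m /ins_radius; apply: leq_trans (leqnSn _).
      by rewrite -addnA; apply: leq_trans (leq_addr _ _); rewrite leq_mul2r szK orbT.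
    - by apply: chain_sub cus => x y xy; apply/orP; left.
  by apply: H; rewrite mem_filter mem_smalls sus andbT; apply/asboolP.
have [u' uu' uH] := sat u uj; have [v' vv' vH] := sat v vj.
exists m, u', v'; split=> //; first by rewrite /m /ins_radius; lia.
move=> us sus; apply: iff_trans (uH us sus) _; apply: iff_trans (iff_sym (vH us sus)).
by apply: uv => //; apply: thm; lia.
Qed.

Lemma ins_value (M : monoidType) (mu : seq Sigma -> M) m w w' :
    eventually_DA M -> mu [::] = 1%g ->
    (forall x y, mu (x ++ y) = mu x * mu y)%g ->
    (forall f : nat -> M, exists i j, [/\ i < j, j <= c & f i = f j]) ->
  c <= m -> ins m w w' -> mu w = mu w'.
Proof.
move=> [n0 H] mu1 muM rep le.
apply: (ins_ind_rel (R := fun w w' => mu w = mu w')) => [//|x y z -> //|].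
move=> _ _ [A [s [s1 [t1 [t [A0 rs rt -> ->]]]]]].
have E : mu (s1 ++ all_words A ++ t1) = mu (s1 ++ t1).
  (* The exponent must be at least [n0] and greater than 1. *)
  apply: (@rich_insert_value M n0.+2 _ _ _ mu mu1 muM A c) => //.
  - by apply: H; lia.
  - exact: rich_leq rs.
  - exact: rich_leq rt.
  - exact: all_all_words.
by rewrite !muM in E *; rewrite !mulgA in E *; rewrite -!(mulgA (mu s)) E.
Qed.

End Insertions.

(** * Windows *)

Lemma subseq_map_inv (T1 T2 : eqType) (f : T1 -> T2) (b : seq T2) (s : seq T1) :
  subseq b (map f s) -> exists2 g, subseq g s & b = map f g.
Proof.
case/subseqP => m _ ->; exists (mask m s); first exact: mask_subseq.
by rewrite map_mask.
Qed.

Lemma subseq_flatten_map (T1 T2 : eqType) (f : T1 -> seq T2) (g s : seq T1) :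
  subseq g s -> subseq (flatten (map f g)) (flatten (map f s)).
Proof.
elim: s g => [|a s IH] [|b g] //=; first by rewrite sub0seq.
case: eqP => [->|_] /IH H; first by apply: cat_subseq.
exact: subseq_trans H (suffix_subseq _ _).
Qed.

Lemma subseq_flatten_map_inv (T1 T2 : eqType) (f : T1 -> seq T2)
    (b : seq T2) (s : seq T1) :
  subseq b (flatten (map f s)) -> exists g,
    [/\ subseq g s, size g <= size b & subseq b (flatten (map f g))].
Proof.
elim: s b => [|a s IH] b /=; first by move=> /eqP ->; exists [::].
case/subseq_cat_split => b1 [b2 [-> s1 /IH[g [gs le s2]]]].
case: b1 s1 => [|c b1] s1.
  by exists g; split=> //; apply: subseq_trans gs (subseq_cons _ _).
exists (a :: g); rewrite /= eqxx size_cat; split=> //; first by rewrite /=; lia.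
exact: (cat_subseq s1 s2).
Qed.

Lemma suffix_consr (T : eqType) (a : T) (u w : seq T) :
  suffix u (a :: w) = (u == a :: w) || suffix u w.
Proof.
apply/suffixP/orP => [[[|b x] /= E]|[/eqP ->|/suffixP[x ->]]].
- by left; rewrite E.
- by right; case: E => _ ->; rewrite suffix_suffix.
- by exists [::].
- by exists (a :: x).
Qed.

Lemma take_cat_congr (T : Type) n (x y z : seq T) : take n y = take n z ->
  take (size x + n) (x ++ y) = take (size x + n) (x ++ z).
Proof. by move=> E; rewrite !take_cat !ltnNge !leq_addr /= addKn E. Qed.

Section Windows.
Variable T : eqType.
Implicit Types (u v w x y : seq T).

(** Windows are truncated at the end of the word, so that a window shorter than
    [n] is a suffix. *)
Fixpoint windows n w :=
  if w is _ :: w' then take n w :: windows n w' else [::].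

Lemma size_windows n w : size (windows n w) = size w.
Proof. by elim: w => //= a w ->. Qed.

Lemma windows_drop n i w : windows n (drop i w) = drop i (windows n w).
Proof. by elim: i w => [|i IH] [|a w] //=; rewrite drop0. Qed.

Lemma windows_cat n x y :
  windows n (x ++ y) = take (size x) (windows n (x ++ y)) ++ windows n y.
Proof.
by rewrite -{1}(cat_take_drop (size x) (windows _ _)) -windows_drop drop_size_cat.
Qed.

Lemma windows_take_congr n m u v : take (m + n) u = take (m + n) v ->
  take m (windows n u) = take m (windows n v).
Proof.
elim: m u v => [|m IH] [|a u] [|b v] //= [-> E].
rewrite (IH u v) // ; congr (_ :: _).
by apply: (@take_prefix_eq _ (m + n).+1); rewrite ?leqW ?leq_addl //= E.
Qed.

Lemma windows_leq n n' w : n <= n' -> windows n w = map (take n) (windows n' w).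
Proof. by move=> le; elim: w => //= a w ->; rewrite take_takel. Qed.

(** Short suffixes are also recorded here, as the truncated windows at the end of the word. *)
Definition wequiv n k u v := take n u = take n v /\
  forall b, size b <= k -> subseq b (windows n u) = subseq b (windows n v).

Lemma wequiv_sym n k u v : wequiv n k u v -> wequiv n k v u.
Proof. by case=> E H; split=> // b /H. Qed.

Lemma wequiv_leq n k n' k' u v : n <= n' -> k <= k' ->
  wequiv n' k' u v -> wequiv n k u v.
Proof.
move=> le le' [E H]; split; first exact: take_prefix_eq le E.
move=> b leb; rewrite !(windows_leq _ le).
have lek (g : seq (seq T)) : b = map (take n) g -> size g <= k'.
  by move=> E'; rewrite -(size_map (take n)) -E'; apply: leq_trans leb le'.
apply/idP/idP => /subseq_map_inv[g gs E'].
  by rewrite E'; apply: map_subseq; rewrite -H // (lek _ E').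
by rewrite E'; apply: map_subseq; rewrite H // (lek _ E').
Qed.

Lemma mem_windows_suffix n u w : u <> [::] -> size u < n ->
  (u \in windows n w) = suffix u w.
Proof.
move=> u0 lt; elim: w => [|a w IH].
  by rewrite suffixs0 /=; apply/esym/negbTE/eqP.
rewrite /= in_cons IH suffix_consr; congr (_ || _).
apply/eqP/eqP => [E|E]; last by rewrite E take_oversize // -E ltnW.
rewrite E take_oversize //.
have := size_take n (a :: w); rewrite -E; case: ltnP => // _ sz.
by rewrite sz ltnn in lt.
Qed.

End Windows.

Lemma subseq_cons_windows (T : eqType) n W (b : seq (seq T)) w :
  subseq (W :: b) (windows n w) -> exists p a w',
    [/\ w = p ++ a :: w', W = take n (a :: w') & subseq b (windows n w')].
Proof.
elim: w => //= a w IH; case: eqP => [-> H|_ /IH[p [c [w' [-> -> H]]]]].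
  by exists [::], a, w.
by exists (a :: p), c, w'.
Qed.

(** For each block the windows starting at the letters of one occurrence are selected. In [w'] the
    first of them spells the block, and the others force the windows of later blocks to start after
    it. *)
Lemma chain_infix_windows (Sigma : finType) n (us : seq (seq Sigma)) w :
    all (fun u => size u <= n) us -> {in us, forall u, u <> [::]} ->
    chain (@infix Sigma) us w ->
  exists b, [/\ size b <= size (flatten us), subseq b (windows n w)
    & forall w', subseq b (windows n w') -> chain (@infix Sigma) us w'].
Proof.
elim: us w => [|u us IH] w /=; first by exists [::]; rewrite sub0seq.
case/andP => le les u0 [x [y [-> /infixP[p [q ->]] /(IH _ les)[|b [szb bs bP]]]]].
  by move=> v vs; apply: u0; rewrite in_cons vs orbT.
exists (take (size u) (windows n (u ++ q ++ y)) ++ b); split.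
- rewrite !size_cat leq_add // size_take; case: ltnP => //.
- rewrite -!catA (windows_cat n p); apply: subseq_trans (suffix_subseq _ _).
  rewrite [windows n (u ++ _) in X in subseq _ X]windows_cat.
  apply: cat_subseq => //; rewrite windows_cat.
  exact: subseq_trans bs (suffix_subseq _ _).
move=> w'; case: u u0 le => [/(_ [::] (mem_head _ _))[]//|a u] _ le.
rewrite [take _ _]/= cat_cons.
case/subseq_cons_windows => p' [a' [w1 [-> E]]].
move=> /subseq_cat_drop.
rewrite size_takel ?size_windows ?size_cat ?leq_addr //  -windows_drop => /bP H'.
exists (p' ++ a' :: take (size u) w1), (drop (size u) w1); split=> //.
  by rewrite -catA /= cat_take_drop.
apply: infix_catl.
suff -> : a :: u = a' :: take (size u) w1 by apply: infix_refl.
have := congr1 (take (size u).+1) E.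
by rewrite !take_takel //= take_size_cat // => - [-> ->].
Qed.

(** * Windows under nonerasing morphisms *)

Section WindowsMorphism.
Variables (G T : eqType) (h : G -> seq T).
Hypothesis h_nonempty : forall a, h a <> [::].
Implicit Types (u v w : seq G) (x y : seq T).

Let H u := flatten (map h u).

Let Hcons a u : H (a :: u) = h a ++ H u. Proof. by []. Qed.

Lemma size_nonerasing u : size u <= size (H u).
Proof.
elim: u => //= a u IH; rewrite /H /= size_cat.
by case: (h a) (@h_nonempty a) => //= b s _; rewrite ltnS (leq_trans IH) // leq_addl.
Qed.

Lemma take_nonerasing n u y : take n (H u ++ y) = take n (H (take n u) ++ y).
Proof.
case: (leqP (size u) n) => [le|lt]; first by rewrite (take_oversize le).
rewrite -{1}(cat_take_drop n u) /H map_cat flatten_cat -catA.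
have le : n <= size (H (take n u)).
  by rewrite (leq_trans _ (size_nonerasing _)) // size_takel // ltnW.
by rewrite !takel_cat.
Qed.

(** As [h] is nonerasing, a window starting inside [h a] depends only on [a] and the next [n]
    letters of [u]. Hence [g] maps a window of width [n.+1] to the list of windows that start in the
    image of its first letter. *)
Lemma windows_morphism n y : exists g, forall u,
  windows n (H u ++ y) = flatten (map g (windows n.+1 u)) ++ windows n y.
Proof.
pose g w := take (size (if w is a :: _ then h a else [::])) (windows n (H w ++ y)).
exists g; elim=> [|a u IH]; first by [].
have -> : flatten (map g (windows n.+1 (a :: u))) =
  g (a :: take n u) ++ flatten (map g (windows n.+1 u)) by [].
rewrite Hcons -catA windows_cat IH -catA; congr (_ ++ _).
apply: windows_take_congr; rewrite Hcons -catA; apply: take_cat_congr.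
exact: take_nonerasing.
Qed.

(** Windows starting in [x] are fixed by the prefix of [u], those starting in [H u] come from
    windows of [u], and those of [y] are common. The part of [b] read in [H u] uses at most as many
    windows of [u] as its length. *)
Lemma wequiv_morphism n k u v x y : wequiv n.+1 k u v ->
  wequiv n k (x ++ H u ++ y) (x ++ H v ++ y).
Proof.
have [g gE] := windows_morphism n y.
have main u' v' : wequiv n.+1 k u' v' -> forall b, size b <= k ->
    subseq b (windows n (x ++ H u' ++ y)) -> subseq b (windows n (x ++ H v' ++ y)).
  case=> E S b leb; rewrite (windows_cat n x (H u' ++ y)) (windows_cat n x (H v' ++ y)).
  have -> : take (size x) (windows n (x ++ H v' ++ y)) =
      take (size x) (windows n (x ++ H u' ++ y)).
    apply: windows_take_congr; apply: take_cat_congr.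
    by rewrite [LHS]take_nonerasing [RHS]take_nonerasing (@take_prefix_eq _ _ n _ _ _ E).
  case/subseq_cat_split => b1 [b' [bE s1]].
  rewrite gE => /subseq_cat_split[b2 [b3 [bE' /subseq_flatten_map_inv[c [cu lec s2]] s3]]].
  rewrite bE bE'; apply: cat_subseq => //; rewrite gE; apply: cat_subseq => //.
  apply: subseq_trans s2 (subseq_flatten_map g _).
  by rewrite -S //; move: leb; rewrite bE bE' !size_cat; lia.
move=> uv; split; last first.
  by move=> b leb; apply/idP/idP; apply: main => //; apply: wequiv_sym.
case: uv => E _; apply: (@take_prefix_eq _ (size x + n)); first by rewrite leq_addl.
apply: take_cat_congr.
by rewrite [LHS]take_nonerasing [RHS]take_nonerasing (@take_prefix_eq _ _ n _ _ _ E).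
Qed.

End WindowsMorphism.

Lemma wequiv_cat (T : eqType) n k (u v x y : seq T) : wequiv n.+1 k u v ->
  wequiv n k (x ++ u ++ y) (x ++ v ++ y).
Proof.
have fE (w : seq T) : flatten [seq [:: a] | a <- w] = w by elim: w => //= a w ->.
have := @wequiv_morphism _ _ (fun a : T => [:: a]) (fun _ => ltac:(by [])) n k u v x y.
by rewrite !fE.
Qed.

(** * Dot-depth one languages and windows *)

Section DotDepthOne.
Variable Sigma : finType.
Implicit Types (L : language Sigma) (u v w : seq Sigma) (us : seq (seq Sigma)).

Lemma suffix_langE u : suffix_lang u = [set w | suffix u w].
Proof.
apply/seteqP; split=> w /=.
  by case=> x _ [y -> <-]; rewrite suffix_suffix.
by case/suffixP => x ->; exists x => //; exists u.
Qed.

Lemma prefix_langE u : prefix_lang u = [set w | prefix u w].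
Proof.
apply/seteqP; split=> w /=.
  by case=> x -> [y _ <-]; rewrite prefix_prefix.
by case/prefixP => x ->; exists u => //; exists x.
Qed.

Lemma factor_langE u : factor_lang u = [set w | infix u w].
Proof.
apply/seteqP; split=> w /=.
  by case=> x [p _ [q -> <-]] [y _ <-]; rewrite -catA infix_infix.
case/infixP => x [y ->]; exists (x ++ u); last by exists y; rewrite ?catA.
by exists x => //; exists u.
Qed.

Lemma marked_langE us : marked_lang us = [set w | chain (@infix Sigma) us w].
Proof.
apply/seteqP; split=> w.
  case=> x _ [y yb <-]; elim: us x y yb => [//|u us IH] x y.
  rewrite big_cons => -[z [v -> [q _ <-]] [y' /(IH q y')]] + <- => H /=.
  by exists (x ++ u), (q ++ y'); rewrite -!catA suffix_infix.
elim: us w => [|u us IH] w.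
  by move=> _; exists w => //; exists [::]; rewrite ?cats0 // big_nil.
case=> x [y [-> /infixP[p [q ->]] /IH[x' _ [y' y'b <-]]]].
exists p => //; exists (u ++ q ++ x' ++ y'); last by rewrite -!catA.
rewrite big_cons; exists (u ++ q ++ x'); last by exists y'; rewrite -?catA.
by exists u => //; exists (q ++ x').
Qed.

Lemma size_flatten_leq us u : u \in us -> size u <= size (flatten us).
Proof.
elim: us => //= v us IH; rewrite in_cons size_cat => /orP[/eqP ->|/IH].
  exact: leq_addr.
by move=> le; apply: leq_trans le (leq_addl _ _).
Qed.

Lemma dot_depth_one_wequiv L : dot_depth_one L ->
  exists n k, forall u v, wequiv n k u v -> L u -> L v.
Proof.
elim=> {L} [A|||].
- case=> [u u0|u u0|us _ us0].
  (* A suffix is recognised as a truncated window, so the width must exceed its length. *)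
  + exists (size u).+1, 1 => v w [_ H]; rewrite suffix_langE /=.
    by rewrite -!(@mem_windows_suffix _ (size u).+1) // -!sub1seq H.
  + exists (size u), 0 => v w [E _]; rewrite prefix_langE /=.
    by rewrite !prefixE E.
  + exists (size (flatten us)), (size (flatten us)) => v w [_ H]; rewrite marked_langE /=.
    case/(@chain_infix_windows _ (size (flatten us))) => //.
      by apply/allP => u; exact: size_flatten_leq.
    by move=> b [leb bv]; apply; rewrite -H.
- by exists 0, 0.
- move=> A B _ [n [k HA]] _ [n' [k' HB]]; exists (maxn n n'), (maxn k k') => u v E.
  case=> [/HA Av|/HB Bv]; [left; apply: Av|right; apply: Bv]; apply: wequiv_leq E;
    by rewrite ?leq_maxl ?leq_maxr.
- move=> A _ [n [k HA]]; exists n, k => u v E nA /(HA v u); apply: contra_not nA.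
  by apply; exact: wequiv_sym.
Qed.

End DotDepthOne.

(** * Selected windows as patterns of factors *)

Section Patterns.
Variable T : eqType.
Implicit Types (u v w x y g : seq T) (gs : seq (seq T)) (b : seq (seq T)).

(** The product g Sigma^* g_1 Sigma^* ... Sigma^* g_k, anchored at both ends of the word. *)
Fixpoint pattern g gs w : Prop :=
  if gs is g' :: gs' then exists x w', w = g ++ x ++ w' /\ pattern g' gs' w'
  else w = g.

Lemma pattern_prefix g gs w : pattern g gs w -> prefix g w.
Proof.
case: gs => [->|g' gs [x [w' [-> _]]]]; [exact: prefix_refl | exact: prefix_prefix].
Qed.

Lemma pattern_cons a g gs w : pattern (a :: g) gs w ->
  exists2 w', w = a :: w' & pattern g gs w'.
Proof.
case: gs => [->|g' gs /= [x [w' [-> P]]]]; first by exists g.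
by exists (g ++ x ++ w') => //; exists x, w'.
Qed.

Lemma cons_pattern a g gs w : pattern g gs w -> pattern (a :: g) gs (a :: w).
Proof. by case: gs => [->|g' gs /= [x [w' [-> P]]]] //; exists x, w'. Qed.

Lemma pattern_last g gs w : pattern g gs w -> suffix (last g gs) w.
Proof.
elim: gs g w => [|g' gs IH] g w /=; first by move=> ->; exact: suffix_refl.
by case=> x [w' [-> /IH H]]; apply/suffix_catr/suffix_catr.
Qed.

(* The selected windows are merged into maximal blocks; [j] asks that the first
   block be long enough to determine the window of the letter that precedes it. *)
Lemma windows_pattern n b w j : subseq b (windows n w) -> j <= n ->
  exists g gs, [/\ pattern g gs w, gs = [::] \/ j <= size g,
    forall w', pattern g gs w' -> subseq b (windows n w'),
    size gs <= (size b).+1 /\ (j = 0 -> g <> [::] -> size gs <= size b)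
    & size g <= j + size b * n.+1 /\
      all (fun g' => size g' <= n + size b * n.+1) gs].
Proof.
elim: w b j => [|a w IH] b j /=.
  move/eqP => -> _; exists [::], [::]; split=> //; [by left|].
  by move=> w' ->.
move=> bw le.
have winS c w' : subseq c (windows n w') -> subseq c (windows n (a :: w')).
  by move=> H; apply: subseq_trans H _; apply: subseq_cons.
(* The case where the window of the first letter is not selected. If [j] is 0 the first block may be
   left empty, and the letter goes into the gap after it; otherwise the letter joins the first
   block. *)
have skip : subseq b (windows n w) -> exists g gs,
    [/\ pattern g gs (a :: w), gs = [::] \/ j <= size g,
      forall w', pattern g gs w' -> subseq b (windows n w'),
      size gs <= (size b).+1 /\ (j = 0 -> g <> [::] -> size gs <= size b)
      & size g <= j + size b * n.+1 /\
        all (fun g' => size g' <= n + size b * n.+1) gs].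
  move=> {}bw; case: j le => [|j] le.
    have [g [gs [P _ bP [s1 s2] [s3 s4]]]] := IH b 0 bw isT.
    case: g P bP s2 s3 => [|c g] P bP s2 s3.
      case: gs P bP s1 s2 s4 => [|g gs] P bP s1 s2 s4.
        exists [::], [:: [::]]; split=> //; [|by right|].
          by exists [:: a], [::]; rewrite /= P.
        by move=> w' _; have /eqP -> := bP [::] erefl; rewrite sub0seq.
      exists [::], (g :: gs); split=> //; last by right.
      by case: P => x [w' [-> P]]; exists (a :: x), w'.
    exists [::], ((c :: g) :: gs); split.
    - by exists [:: a], w.
    - by right.
    - move=> w' [x [w1 [-> /bP H]]]; apply: subseq_trans H _.
      by rewrite cat0s (windows_cat n x); exact: suffix_subseq.
    - by split=> //=; rewrite ltnS s2.
    - by split=> //=; rewrite s4 andbT -/(size (c :: g)); apply: leq_trans s3 _; rewrite leq_add2r.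
  have [g [gs [P gj bP [s1 _] [s3 s4]]]] := IH b j bw (ltnW le).
  exists (a :: g), gs; split.
  - exact: cons_pattern.
  - by case: gj => gj; [left|right].
  - by move=> w' /pattern_cons[w1 -> /bP]; exact: winS.
  - by [].
  - by [].
case: b bw skip => [|W b] bw skip; first by apply: skip; rewrite sub0seq.
case: eqP bw => [-> {skip}|_] bw; last exact: skip.
(* The window of the first letter is selected, so [n] further letters are requested in its block,
   unless that block reaches the end of the word. *)
have [g [gs [P gj bP [s1 _] [s3 s4]]]] := IH b n bw (leqnn n).
have le' : n + size b * n.+1 <= n + (size b).+1 * n.+1.
  by rewrite leq_add2l leq_mul2r leqnSn orbT.
exists (a :: g), gs; split.
- exact: cons_pattern.
- by case: gj => gj; [left|right; rewrite /= (leq_trans le) // (leq_trans gj)].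
- move=> w' P'; have [w1 E P1] := pattern_cons P'; rewrite E /=.
  have -> : take n (a :: w) = take n (a :: w1).
    case: gj => gj.
      by rewrite gj /= in P P1; rewrite P P1.
    apply: (@take_prefix_eq _ (n.+1)) => //=; congr (_ :: _).
    have := pattern_prefix P; have := pattern_prefix P1.
    move=> /prefixP[x1 ->] /prefixP[x2 ->].
    by rewrite !takel_cat.
  by rewrite eqxx; exact: bP.
- by split=> //=; lia.
- split; first by rewrite /= mulSn; lia.
  by apply: sub_all s4 => g' /= H; apply: leq_trans H le'.
Qed.

End Patterns.

(** * From prefix, suffix and marked tests to windows *)

Section TestsToWindows.
Variable Sigma : finType.
Implicit Types (u v w g : seq Sigma) (gs : seq (seq Sigma)).

Lemma chain_infix_size gs w u : u \in gs -> chain (@infix Sigma) gs w ->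
  size u <= size w.
Proof.
elim: gs w => //= g gs IH w; rewrite in_cons => /orP[/eqP ->|/IH{}IH] [x [y [-> gx]]].
  by move=> _; rewrite size_cat (leq_trans (size_infix gx)) // leq_addr.
by move/IH => le; rewrite size_cat (leq_trans le) // leq_addl.
Qed.

Lemma chain_pattern_tail g gs w : chain (@infix Sigma) (g :: gs) w ->
  suffix (last g gs) w -> exists x w', w = x ++ w' /\ pattern g gs w'.
Proof.
elim: gs g w => [|g' gs IH] g w.
  by move=> _ /suffixP[x ->]; exists x, g.
case=> x [y [-> /infixP[p [q ->]] c]] S.
have le := chain_infix_size (mem_last g' gs) c.
rewrite /= suffix_catr_le // in S.
have [x' [w' [-> P]]] := IH _ _ c S.
by exists p, (g ++ (q ++ x') ++ w'); rewrite -!catA; split=> //; exists (q ++ x'), w'; rewrite -!catA.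
Qed.

(** With at least two blocks, the first can be moved to the start of the word and the last to its
    end without disturbing the order. *)
Lemma chain_pattern g gs w : gs <> [::] -> chain (@infix Sigma) (g :: gs) w ->
  prefix g w -> suffix (last g gs) w -> pattern g gs w.
Proof.
case: gs => // g' gs _ [x [y [-> gx c]]].
have := size_infix gx => le.
rewrite prefix_catl_le // => /prefixP[x' ->] S.
have le' := chain_infix_size (mem_last g' gs) c.
rewrite suffix_catr_le // in S.
have [p [w' [-> P]]] := chain_pattern_tail c S.
by exists (x' ++ p), w'; rewrite -!catA.
Qed.

Lemma pattern_chain g gs w : pattern g gs w -> chain (@infix Sigma) (g :: gs) w.
Proof.
elim: gs g w => [|g' gs IH] g w.
  by move=> ->; exists g, [::]; rewrite cats0; split=> //; exact: infix_refl.
by case=> x [w' [-> /IH H]]; exists (g ++ x), w'; rewrite -catA prefix_infix.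
Qed.

Lemma prefix_tests_take N u v :
  (forall p, size p <= N -> prefix p u = prefix p v) -> take N u = take N v.
Proof.
move=> H.
have le w : size (take N w) <= N by rewrite size_take; case: ltnP.
have Pu : prefix (take N u) v by rewrite -H // prefix_take.
have Pv : prefix (take N v) u by rewrite H // prefix_take.
have [lt|ge] := ltnP (size u) N; last first.
  by move: Pu; rewrite prefixE size_takel // => /eqP ->.
rewrite take_oversize ?(ltnW lt) // in Pu *.
have ltv : size v < N.
  rewrite ltnNge; apply/negP => ge; have := size_prefix Pv.
  by rewrite size_takel // leqNgt lt.
rewrite take_oversize ?(ltnW ltv) // in Pv *.
have E : size u = size v by apply/eqP; rewrite eqn_leq !size_prefix.
by move: Pu; rewrite prefixE E take_size => /eqP.
Qed.

(** At most [k] windows give a pattern of at most [k.+2] blocks shorter than [N], and a pattern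
    amounts to one marked test and a test at each end. *)
Lemma tests_wequiv n k N K u v : n + k * n.+1 < N -> k.+2 <= K ->
    (forall p, size p <= N -> prefix p u = prefix p v) ->
    (forall p, size p <= N -> suffix p u = suffix p v) ->
    (forall us, small N K us ->
       chain (@infix Sigma) us u <-> chain (@infix Sigma) us v) ->
  wequiv n k u v.
Proof.
move=> leN leK pre suf ch.
have main u' v' b : (forall p, size p <= N -> prefix p u' = prefix p v') ->
    (forall p, size p <= N -> suffix p u' = suffix p v') ->
    (forall us, small N K us ->
       chain (@infix Sigma) us u' -> chain (@infix Sigma) us v') ->
    size b <= k -> subseq b (windows n u') -> subseq b (windows n v').
  move=> pre' suf' ch' leb bu.
  have [g [gs [P _ bP [s1 _] [s2 s3]]]] := windows_pattern bu (leq0n n).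
  have leNb : n + size b * n.+1 < N.
    by apply: leq_ltn_trans leN; rewrite leq_add2l leq_mul2r leb orbT.
  have gN : size g < N by apply: leq_ltn_trans leNb; apply: leq_trans s2 _; rewrite leq_add2r.
  have gsN : all (fun g' => size g' <= N) gs.
    by apply: sub_all s3 => g' H; apply: leq_trans H (ltnW _).
  (* With a single block, the pattern is the word [u'] itself; it is shorter than [N], so the prefix
     tests determine it. *)
  apply: bP; case: (gs =P [::]) => [E|ne].
    rewrite E /= in P *; have := prefix_tests_take pre'; rewrite P => T.
    rewrite take_oversize 1?ltnW // in T; rewrite T take_oversize //.
    rewrite leqNgt; apply/negP => lt.
    by move: gN; rewrite T size_takel ?ltnn // ltnW.
  apply: chain_pattern => //.
  - apply: ch'; last exact: pattern_chain.
    by rewrite /small /= gsN (ltnW gN) (leq_trans _ leK) // !ltnS (leq_trans s1).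
  - by rewrite -pre' ?(pattern_prefix P) // ltnW.
  - rewrite -suf' ?(pattern_last P) //.
    by case: (gs) gsN ne => // g' gs' /allP H _; exact: (H _ (mem_last g' gs')).
split.
  exact: take_prefix_eq (leq_trans (leq_addr _ _) (ltnW leN)) (prefix_tests_take pre).
move=> b leb; apply/idP/idP; apply: main => //; try by move=> p /pre.
- by move=> us /ch[].
- by move=> p /suf.
- by move=> us /ch[].
Qed.

End TestsToWindows.

(** * Varieties *)

Lemma finite_inj (T U : Type) (f : T -> U) (B : set U) :
  injective f -> (forall x, B (f x)) -> finite_set B -> finite_set [set: T].
Proof.
move=> fI fB finB; apply: sub_finite_set (finite_preimage (f := f) _ finB).
  by move=> x _; exact: fB.
by move=> x y _ _ /fI.
Qed.

(** Elements are coded by positions in enumerations of the factors; [B] gives all coordinates a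
    common index type. *)
Lemma finite_prod_semigroup (I : finType) (S : I -> semigroupType) :
  (forall i, finite_set [set: S i]) -> finite_set [set: prod_semigroup S].
Proof.
move=> fin.
have ex i : exists s : seq (S i), forall x, x \in s.
  have /finite_seqP[s sE] := fin i; exists s => x.
  by have : [set: S i] x by []; rewrite sE.
pose s i := projT1 (cid (ex i)); have sP i x : x \in s i := projT2 (cid (ex i)) x.
pose B := \max_i size (s i).
have lt i x : index x (s i) < B.+1.
  by rewrite ltnS (leq_trans (index_size _ _)) // (leq_bigmax i).
pose g (f : prod_semigroup S) : {ffun I -> 'I_B.+1} :=
  [ffun i => Ordinal (lt i (f i))].
apply: (@finite_inj _ _ g setT) => // f f' E.
apply/ffunP => i; have := congr1 (fun h : {ffun I -> 'I_B.+1} => val (h i)) E.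
rewrite !ffunE /= => Ei.
by rewrite -(nth_index (f i) (sP i (f i))) Ei nth_index.
Qed.

Section SubFinite.
Variables (S : semigroupType) (P : pred S) (T : subSemigroupType P).

Lemma finite_subsemigroup : finite_set [set: S] -> finite_set [set: T].
Proof. by apply: (@finite_inj _ _ (val : T -> S)) => //; exact: val_inj. Qed.

End SubFinite.

Lemma finite_image_semigroup (S T : semigroupType) (f : S -> T) :
  set_surj setT setT f -> finite_set [set: S] -> finite_set [set: T].
Proof. by move=> fS /(finite_image f); apply: sub_finite_set. Qed.

Section SemigroupPower.
Local Open Scope group_scope.

(** Semigroups have no unit: the exponent of [spow x n] is [n.+1]. *)
Definition spow (S : semigroupType) (x : S) n := iter n (mul x) x.

Lemma spow_morph (S T : semigroupType) (f : S -> T) x n :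
  {morph f : x y / x * y} -> f (spow x n) = spow (f x) n.
Proof. by move=> fM; elim: n => //= n IH; rewrite fM IH. Qed.

Lemma spow_expg (M : monoidType) (x : M) n : spow x n = x ^+ n.+1.
Proof. by elim: n => // n IH; rewrite expgS -IH. Qed.

(** A variety of semigroups containing DA, hence an upper bound for [DA_S]. *)
Definition DA_semigroup (S : semigroupType) := finite_set [set: S] /\
  exists N, forall n, N <= n -> forall x y : S,
    spow (x * y) n * x * spow (x * y) n = spow (x * y) n.

Lemma DA_semigroup_variety : variety DA_semigroup.
Proof.
split=> [S []//|S P T [fin [N H]]|I S H|S T f fS [fin [N H]]].
- split; first exact: finite_subsemigroup fin.
  exists N => n le x y; apply: val_inj.
  by rewrite !valM !(spow_morph _ _ (@valM _ _ T)) valM H.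
- split; first by apply: finite_prod_semigroup => i; case: (H i).
  have ex i := (H i).2; pose N i := projT1 (cid (ex i)).
  have NP i n : N i <= n -> _ := projT2 (cid (ex i)) n.
  exists (\max_i N i) => n le x y; apply/ffunP => i.
  have M z t : (z * t : prod_semigroup S) i = z i * t i by rewrite ffunE.
  have mi : {morph (fun z : prod_semigroup S => z i) : z t / z * t} by move=> z t; exact: M.
  rewrite !M !(spow_morph _ _ mi) M; apply: NP; exact: leq_trans (leq_bigmax i) le.
- split; first exact: finite_image_semigroup fS fin.
  exists N => n le x y; have [x' _ <-] := fS x I; have [y' _ <-] := fS y I.
  by rewrite -gmulfM -(spow_morph _ _ (@gmulfM _ _ f)) -!gmulfM H.
Qed.

Lemma DA_DA_semigroup (M : monoidType) : DA M -> DA_semigroup M.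
Proof.
move=> da; split; first by case: da.
by have [N H] := DA_eventually da; exists N => n le x y; rewrite !spow_expg H // leqW.
Qed.

End SemigroupPower.

(** Morphisms from the free semigroup on [G] are represented by functions on all
    words, with a junk value at the empty word. *)
Definition windows_semigroup (S : semigroupType) := finite_set [set: S] /\
  forall (G : finType) (phi : seq G -> S),
    (forall u v, u <> [::] -> v <> [::] -> phi (u ++ v) = (phi u * phi v)%g) ->
  exists n k, forall u v, u <> [::] -> v <> [::] -> wequiv n k u v -> phi u = phi v.

Lemma lift_free_morphism (S : semigroupType) (G : finType) (f : G -> S) (s0 : S) :
  exists2 phi : seq G -> S, forall a, phi [:: a] = f a &
    forall u v, u <> [::] -> v <> [::] -> phi (u ++ v) = (phi u * phi v)%g.
Proof.
pose phi u := if u is a :: u' then foldl (fun s b => s * f b)%g (f a) u' else s0.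
exists phi => // [[|a u] [|b v]] // _ _.
have F s t w : foldl (fun s b => s * f b)%g (s * t)%g w =
    (s * foldl (fun s b => s * f b)%g t w)%g.
  by elim: w t => //= c w IH t; rewrite -mulgA IH.
by rewrite /= foldl_cat /= F.
Qed.

Lemma windows_semigroup_variety : variety windows_semigroup.
Proof.
split=> [S []//|S P T [fin H]|I S H|S T f fS [fin H]].
- split; first exact: finite_subsemigroup fin.
  move=> G phi phiM; have [|n [k nk]] := H G (fun u => val (phi u)).
    by move=> u v u0 v0; rewrite phiM // valM.
  by exists n, k => u v u0 v0 uv; apply/val_inj/nk.
- split; first by apply: finite_prod_semigroup => i; case: (H i).
  move=> G phi phiM.
  have ex i : exists nk, forall u v, u <> [::] -> v <> [::] ->
      wequiv nk.1 nk.2 u v -> phi u i = phi v i.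
    have [|n [k nk]] := (H i).2 G (fun u => phi u i); last by exists (n, k).
    by move=> u v u0 v0; rewrite phiM // ffunE.
  pose nk i := projT1 (cid (ex i)); have nkP i := projT2 (cid (ex i)).
  exists (\max_i (nk i).1), (\max_i (nk i).2) => u v u0 v0 uv.
  apply/ffunP => i; apply: nkP => //; apply: wequiv_leq uv.
    exact: (leq_bigmax i).
  exact: (leq_bigmax (F := fun i => (nk i).2) i).
- split; first exact: finite_image_semigroup fS fin.
  (* The morphism into the image is lifted through [f] letter by letter. *)
  move=> G phi phiM; have /choice[g gP] : forall a, exists s, f s = phi [:: a].
    by move=> a; have [s _ <-] := fS (phi [:: a]) I; exists s.
  have [s0 _ _] := fS (phi [::]) I.
  have [psi psi1 psiM] := lift_free_morphism g s0.
  have [n [k nk]] := H G psi psiM.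
  have E u : u <> [::] -> phi u = f (psi u).
    elim: u => // a [|b u] IH _; first by rewrite psi1 gP.
    by rewrite -cat1s phiM // psiM // gmulfM -IH // psi1 gP.
  by exists n, k => u v u0 v0 uv; rewrite !E // (nk u v).
Qed.

(** * Syntactic monoids *)

Section Synt.
Variables (Sigma : finType) (L : language Sigma).

Lemma synt_monoid_case (a : synt_monoid L) :
  a = 1%g \/ exists2 s : synt_semigroup L, a = val s & True.
Proof.
rewrite -(synt_morph_repr a); case: (repr a) => [|b w]; first by left.
right; have p : synt_plus (synt_morph L (b :: w)) by apply/asboolP; exists (b :: w).
by exists (exist (@synt_plus Sigma L) _ p : synt_semigroup L).
Qed.

Lemma finite_synt_monoid :
  finite_set [set: synt_semigroup L] -> finite_set [set: synt_monoid L].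
Proof.
move=> fin; apply: (@sub_finite_set _ _ ([set 1%g] `|` val @` [set: synt_semigroup L])).
  by move=> a _; case: (synt_monoid_case a) => [->|[s ->]]; [left|right; exists s].
by rewrite finite_setU; split; [exact: finite_set1 | exact: finite_image].
Qed.

Lemma synt_morph_lang u v : synt_morph L u = synt_morph L v -> L u -> L v.
Proof.
move/synt_morph_eq/asboolP/(_ [::] [::]); rewrite !cats0 /=.
by case.
Qed.

Local Open Scope group_scope.

(** When [x] or [y] is the unit, the identity concerns powers of one element and follows from
    aperiodicity. *)
Lemma DA_semigroup_synt : DA_semigroup (synt_semigroup L) -> DA (synt_monoid L).
Proof.
case=> fin [N H]; apply: eventually_DA_DA; first exact: finite_synt_monoid.
have vM (r q : synt_semigroup L) : val r * val q = val (r * q).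
  by rewrite (@valM _ _ (synt_semigroup L)).
have Hm n (s t : synt_semigroup L) : N < n -> let x := val s in let y := val t in
    (x * y) ^+ n * x * (x * y) ^+ n = (x * y) ^+ n.
  case: n => // n le /=.
  have pM (r : synt_semigroup L) : val r ^+ n.+1 = val (spow r n).
    by rewrite -spow_expg (spow_morph _ _ (@valM _ _ (synt_semigroup L))).
  by rewrite !vM pM !vM H.
(* For [e = a ^+ (3 * N.+1)], the two instances give [e a e = e] and [e a a e = e]. Powers of [a]
   commute, so [e a = e a e a = e a a e = e]. *)
have per (s : synt_semigroup L) : val s ^+ (3 * N.+1).+1 = val s ^+ (3 * N.+1).
  have h1 := Hm N.+1 s (s * s) (leqnn _); have h2 := Hm N.+1 (s * s) s (leqnn _).
  move: h1 h2; cbv zeta; rewrite -!vM; set a := val s => h1 h2.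
  have a3 : a * (a * a) = a ^+ 3 by [].
  have a3' : a * a * a = a ^+ 3 by rewrite -mulgA.
  rewrite a3 -!expgnA in h1; rewrite a3' -!expgnA in h2.
  rewrite expgSr -{1}h1 -[in LHS]mulgA -expgSr expgS -[RHS]h2.
  by rewrite -{1}expgS {1}expgSr !mulgA.
have stab (s : synt_semigroup L) m : 3 * N.+1 <= m -> val s ^+ m = val s ^+ (3 * N.+1).
  move=> le; rewrite -(subnKC le); elim: (m - _) => [|k IH]; first by rewrite addn0.
  by rewrite addnS expgSr IH -expgSr per.
exists (3 * N.+1)%N => n le x y.
case: (synt_monoid_case x) => [->|[s -> _]].
  rewrite mul1g mulg1; case: (synt_monoid_case y) => [->|[t -> _]].
    by rewrite expg1n mul1g.
  by rewrite -expgnDr !stab //; lia.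
case: (synt_monoid_case y) => [->|[t -> _]].
  by rewrite mulg1 -expgSr -expgnDr !stab //; lia.
by apply: Hm; lia.
Qed.

End Synt.

(** * Boolean combinations *)

Section BoolComb.
Variables (T : Type) (C : set (set T)).
Implicit Types A B L : set T.

Lemma bool_combT : bool_comb C setT.
Proof. by rewrite -setC0; apply: bool_combC; exact: bool_comb0. Qed.

Lemma bool_combI A B : bool_comb C A -> bool_comb C B -> bool_comb C (A `&` B).
Proof.
move=> cA cB; rewrite -[A `&` B]setCK setCI.
by apply: bool_combC; apply: bool_combU; exact: bool_combC.
Qed.

Lemma bool_comb_sub (C' : set (set T)) L :
  (forall A, C A -> bool_comb C' A) -> bool_comb C L -> bool_comb C' L.
Proof.
move=> sub; elim=> {L} [A /sub //||A B _ HA _ HB|A _ HA].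
- exact: bool_comb0.
- exact: bool_combU.
- exact: bool_combC.
Qed.

Lemma bool_comb_bigU (I : eqType) (s : seq I) (F : I -> set T) :
  (forall i, i \in s -> bool_comb C (F i)) ->
  bool_comb C [set w | exists2 i, i \in s & F i w].
Proof.
elim: s => [|i s IH] H.
  by rewrite (_ : [set _ | _] = set0); [exact: bool_comb0 | apply/seteqP; split=> w [] ].
rewrite (_ : [set _ | _] = F i `|` [set w | exists2 j, j \in s & F j w]).
  apply: bool_combU; first by apply: H; rewrite mem_head.
  by apply: IH => j js; apply: H; rewrite in_cons js orbT.
apply/seteqP; split=> w /=.
  by case=> j; rewrite in_cons => /orP[/eqP ->|js] Fw; [left|right; exists j].
case=> [Fw|[j js Fw]]; first by exists i; rewrite ?mem_head.
by exists j; rewrite // in_cons js orbT.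
Qed.

(** The language is split by the value of the first test, and each part is closed under agreement on
    the remaining tests before induction applies. *)
Lemma bool_comb_tests (I : eqType) (s : seq I) (F : I -> set T) L :
    (forall i, i \in s -> bool_comb C (F i)) ->
    (forall u v, (forall i, i \in s -> F i u <-> F i v) -> L u -> L v) ->
  bool_comb C L.
Proof.
elim: s L => [|i s IH] L CF sat.
  have [[u Lu]|no] := pselect (exists u, L u).
    rewrite (_ : L = setT); first exact: bool_combT.
    by apply/seteqP; split=> // v _; apply: sat Lu.
  rewrite (_ : L = set0); first exact: bool_comb0.
  by apply/seteqP; split=> // v Lv; case: no; exists v.
pose eqv u v := forall j, j \in s -> F j u <-> F j v.
pose L1 := [set v | exists u, [/\ F i u, L u & eqv u v]].
pose L2 := [set v | exists u, [/\ ~ F i u, L u & eqv u v]].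
have LE : L = (F i `&` L1) `|` (~` F i `&` L2).
  apply/seteqP; split=> v.
    by move=> Lv; have [Fv|nFv] := pselect (F i v); [left|right]; split=> //; exists v.
  by case=> -[Fv [u [Fu Lu uv]]]; apply: sat Lu => j; rewrite in_cons => /orP[/eqP ->|/uv].
have CFs j : j \in s -> bool_comb C (F j).
  by move=> js; apply: CF; rewrite in_cons js orbT.
have eT u v w : eqv u v -> eqv v w -> eqv u w.
  by move=> uv vw j js; apply: iff_trans (uv j js) (vw j js).
have Ci := CF i (mem_head i s).
rewrite LE; apply: bool_combU; apply: bool_combI => //.
- by apply: IH => // u v uv [w [Fw Lw wu]]; exists w; split=> //; exact: eT wu uv.
- exact: bool_combC.
- by apply: IH => // u v uv [w [Fw Lw wu]]; exists w; split=> //; exact: eT wu uv.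
Qed.

End BoolComb.

(** * Threshold dot-depth one languages *)

Section Languages.
Variable Sigma : finType.
Implicit Types (L : language Sigma) (u v w x y p q : seq Sigma).
Implicit Types (us : seq (seq Sigma)).

Lemma threshold_blockE l u : threshold_block l u = [set w | blk l u w].
Proof.
rewrite /threshold_block factor_langE; apply/seteqP; split=> w /=.
  by case=> H; apply/orP; [left|right].
by case/orP=> H; [left|right].
Qed.

Lemma infix_ctx u x y z : infix u x -> infix u (y ++ x ++ z).
Proof. by move=> H; apply/infix_catl/infix_catr. Qed.

Lemma blk_ctx l u x y z : blk l u x -> blk l u (y ++ x ++ z).
Proof.
case/orP=> H; apply/orP; [left; exact: infix_ctx|right].
by apply: subseq_trans H _; apply: subseq_trans (suffix_subseq y _); exact: prefix_subseq.
Qed.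

Lemma threshold_langE l us : us <> [::] ->
  threshold_lang l us = [set w | chain (blk l) us w].
Proof.
rewrite /threshold_lang => us0; apply/seteqP; split=> w.
  move=> H; elim: us w H {us0} => [//|u us IH] w.
  rewrite big_cons threshold_blockE => -[x bx [y /IH cy <-]].
  by exists x, y.
case: us us0 => // u us _; elim: us u w => [|v us IH] u w.
  case=> x [y [-> bx _]]; rewrite big_cons big_nil threshold_blockE.
  by exists (x ++ y); [exact: (blk_ctx [::] y bx) | exists [::]; rewrite ?cats0].
case=> x [y [-> bx /IH cy]]; rewrite big_cons threshold_blockE.
by exists x => //; exists y.
Qed.

Lemma chain_filter (b : rel (seq Sigma)) us w : b [::] [::] -> (forall u x y z, b u x -> b u (y ++ x ++ z)) ->
  chain b us w <-> chain b [seq u <- us | u != [::]] w.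
Proof.
move=> b0 bM; have shift vs x y : chain b vs y -> chain b vs (x ++ y).
  case: vs => // v vs [z [t [-> bz ct]]]; exists (x ++ z), t; rewrite catA; split=> //.
  by have := bM v z x [::] bz; rewrite cats0.
elim: us w => [//|u us IH] w /=; case: (eqVneq u [::]) => [->|u0] /=.
  split=> [[x [y [-> _ /IH]]]|/IH c]; first exact: shift.
  by exists [::], w.
by split=> -[x [y [-> bx /IH c]]]; exists x, y.
Qed.

Lemma threshold_test_bool_comb l us :
  bool_comb (@threshold_gen Sigma) [set w | chain (blk l) us w].
Proof.
case: l => [|l].
  rewrite (_ : [set _ | _] = setT); first exact: bool_combT.
  apply/seteqP; split=> // w _ /=; elim: us w => //= u us IH w.
  by exists [::], w; split=> //; rewrite /blk sub0seq orbT.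
set vs := [seq u <- us | u != [::]].
have vsE w : chain (blk l.+1) us w <-> chain (blk l.+1) vs w.
  by apply: chain_filter => // *; apply: blk_ctx.
rewrite (_ : [set _ | _] = [set w | chain (blk l.+1) vs w]); last first.
  by apply/seteqP; split=> w /= /vsE.
have [E|/eqP ne] := eqVneq vs [::].
  by rewrite E (_ : [set _ | _] = setT); [exact: bool_combT | apply/seteqP].
rewrite -threshold_langE //; apply: bool_comb_gen; apply: threshold_gen_block => //.
by move=> u; rewrite mem_filter => /andP[/eqP].
Qed.

Lemma prefix_test_bool_comb p : bool_comb (@threshold_gen Sigma) [set w | prefix p w].
Proof.
have [->|/eqP p0] := eqVneq p [::].
  rewrite (_ : [set _ | _] = setT); first exact: bool_combT.
  by apply/seteqP; split=> // w _ /=; rewrite prefix0s.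
by rewrite -prefix_langE; apply: bool_comb_gen; exact: threshold_gen_prefix.
Qed.

Lemma suffix_test_bool_comb p : bool_comb (@threshold_gen Sigma) [set w | suffix p w].
Proof.
have [->|/eqP p0] := eqVneq p [::].
  rewrite (_ : [set _ | _] = setT); first exact: bool_combT.
  by apply/seteqP; split=> // w _ /=; rewrite suffix0s.
by rewrite -suffix_langE; apply: bool_comb_gen; exact: threshold_gen_suffix.
Qed.

Lemma chain_infix_cat us vs w : chain (@infix Sigma) (us ++ vs) w <->
  exists x y, [/\ w = x ++ y, chain (@infix Sigma) us x & chain (@infix Sigma) vs y].
Proof.
elim: us w => [|u us IH] w /=.
  split=> [c|[x [y [-> _]]]]; first by exists [::], w.
  case: vs => // v vs [z [t [-> bz ct]]]; exists (x ++ z), t; rewrite catA; split=> //.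
  exact: infix_catl.
split=> [[x [y [-> bx /IH[x' [y' [-> cx cy]]]]]]|[_ [y [-> [x1 [x2 [-> bx cx]]] cy]]]].
  by exists (x ++ x'), y'; rewrite catA; split=> //; exists x, x'.
by exists x1, (x2 ++ y); rewrite catA; split=> //; apply/IH; exists x2, y.
Qed.

Lemma chain_infix_letters v w :
  chain (@infix Sigma) [seq [:: a] | a <- v] w <-> subseq v w.
Proof.
elim: v w => [|a v IH] w /=; first by rewrite sub0seq.
split=> [[x [y [-> ax /IH vy]]]|].
  by apply: (@cat_subseq _ [:: a]) => //; rewrite sub1seq -infix1s.
rewrite -cat1s => /cat_subseq_split[x [y [-> ax vy]]]; exists x, y; split=> //.
  by rewrite infix1s -sub1seq.
exact/IH.
Qed.

(** The union defining [u]_l is distributed over the product: each [u] is kept as a factor or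
    replaced by the letters of [u^l]. *)
Fixpoint marked_expansion l us : seq (seq (seq Sigma)) :=
  if us is u :: us' then
    [seq [:: u] ++ vs | vs <- marked_expansion l us'] ++
    [seq [seq [:: a] | a <- word_pow u l] ++ vs | vs <- marked_expansion l us']
  else [:: [::]].

Lemma chain_blk_expansion l us w : chain (blk l) us w <->
  exists2 vs, vs \in marked_expansion l us & chain (@infix Sigma) vs w.
Proof.
elim: us w => [|u us IH] w; first by split=> // _; exists [::].
rewrite [marked_expansion _ _]/=; split=> [[x [y [-> bx /IH[vs vsm c]]]]|[vs]].
  case/orP: bx => bx.
    exists ([:: u] ++ vs); last by exists x, y.
    by rewrite mem_cat; apply/orP; left; apply/mapP; exists vs.
  exists ([seq [:: a] | a <- word_pow u l] ++ vs).
    by rewrite mem_cat; apply/orP; right; apply/mapP; exists vs.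
  by apply/chain_infix_cat; exists x, y; split=> //; apply/chain_infix_letters.
rewrite mem_cat => /orP[] /mapP[vs' vsm ->].
  by case=> x [y [-> ux c]]; exists x, y; split=> //; [apply/orP; left|apply/IH; exists vs'].
case/chain_infix_cat=> x [y [-> /chain_infix_letters H c]]; exists x, y; split=> //.
  by apply/orP; right.
by apply/IH; exists vs'.
Qed.

Lemma marked_expansion_nonempty l us vs : {in us, forall u, u <> [::]} ->
  vs \in marked_expansion l us -> {in vs, forall v, v <> [::]}.
Proof.
elim: us vs => [|u us IH] vs us0 /=; first by rewrite inE => /eqP ->.
have us0' : {in us, forall u, u <> [::]}.
  by move=> v vus; apply: us0; rewrite in_cons vus orbT.
rewrite mem_cat => /orP[] /mapP[vs' /(IH _ us0') H ->] v.
  by rewrite in_cons => /orP[/eqP ->|/H //]; apply: us0; rewrite mem_head.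
by rewrite mem_cat => /orP[/mapP[a _ ->]|/H].
Qed.

Lemma threshold_dot_depth_one_dot_depth_one L :
  threshold_dot_depth_one L -> dot_depth_one L.
Proof.
apply: bool_comb_sub => {L} _ [u u0|u u0|l us _ us_ne us0].
- by apply: bool_comb_gen; exact: dot_depth_one_gen_suffix.
- by apply: bool_comb_gen; exact: dot_depth_one_gen_prefix.
rewrite threshold_langE // (_ : [set _ | _] =
    [set w | exists2 vs, vs \in marked_expansion l us & chain (@infix Sigma) vs w]).
  apply: bool_comb_bigU => vs vsm.
  rewrite -[chain _ _]/[set w | chain (@infix Sigma) vs w] -marked_langE.
  have [->|/eqP ne] := eqVneq vs [::].
    by rewrite marked_langE; exact: bool_combT.
  apply: bool_comb_gen; apply: dot_depth_one_gen_marked => //.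
  exact: marked_expansion_nonempty vsm.
by apply/seteqP; split=> w /chain_blk_expansion.
Qed.

(** The identity of [eventually_DA], read in all contexts of [L]. *)
Definition DA_lang L := exists N, forall n, N <= n -> forall x y p q,
  let z := word_pow (x ++ y) n in L (p ++ z ++ x ++ z ++ q) <-> L (p ++ z ++ q).

Lemma word_powD u m n : word_pow u (m + n) = word_pow u m ++ word_pow u n.
Proof. by rewrite /word_pow nseqD flatten_cat. Qed.

Lemma rich_word_pow u n : rich (alph u) n (word_pow u n).
Proof.
exists (nseq n u); split; rewrite ?size_nseq // => v.
by rewrite mem_nseq => /andP[_ /eqP ->].
Qed.

Lemma size_word_pow_geq u n : u <> [::] -> n <= size (word_pow u n).
Proof. by rewrite size_word_pow; case: u => // a u _; rewrite leq_pmulr. Qed.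

Lemma word_pow_nil n : word_pow [::] n = [::] :> seq Sigma.
Proof. by elim: n. Qed.

(** The longer word arises from the shorter one by inserting [z] between [W R] and [W (n - R)].
    Deletion of [z] is [chain_blk_delete]; its insertion is harmless because [z] begins with
    [W (n - R)], which has [u^l] as a subword for every short [u] over [A]. *)
Lemma threshold_lang_DA l us : DA_lang [set w | chain (blk l) us w].
Proof.
pose N := size (flatten us); pose C := l.+1 * N; pose R := size us * C + N.
exists (R + R + l * N) => n le x y p q /=.
have [/eqP E|xy0] := eqVneq (x ++ y) [::].
  rewrite -size_eq0 size_cat addn_eq0 !size_eq0 in E.
  by case/andP: E => /eqP -> /eqP ->; rewrite word_pow_nil.
have les : all (fun u => size u <= N) us by apply/allP => u; exact: size_flatten_leq.
set A := alph (x ++ y).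
have A0 : A != finset.set0.
  have [a axy] : exists a, a \in x ++ y.
    by case: (x ++ y) xy0 => // a s _; exists a; rewrite mem_head.
  by apply/finset.set0Pn; exists a; rewrite inE.
have xA : all [in A] x by have := all_alph (x ++ y); rewrite all_cat => /andP[].
have rw k : rich A k (word_pow (x ++ y) k) by exact: rich_word_pow.
set W := word_pow (x ++ y); rewrite -!/(W _).
have WE : W n = W R ++ W (n - R) by rewrite -word_powD subnKC //; lia.
pose z := W (n - R) ++ x ++ W R.
have -> : p ++ W n ++ x ++ W n ++ q = p ++ W R ++ z ++ W (n - R) ++ q.
  by rewrite WE /z -!catA.
have -> : p ++ W n ++ q = p ++ W R ++ W (n - R) ++ q by rewrite WE -!catA.
have leN : N <= R by exact: leq_addl.
have st : near_start N A (W (n - R) ++ q).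
  by apply: (near_start_leq _ (rich_near_start A0 (rw (n - R)))); lia.
split=> /= c.
  apply: (chain_blk_delete (N := N) (C := C) (z := z) A0 les _ _ _ leN (rw R) _ st c).
  - by rewrite leq_mul2r leqnSn orbT.
  - by rewrite leq_pmull.
  - exact: leq_addr.
  - by rewrite !all_cat xA !(rich_all (rw _)).
rewrite (catA p); apply: (chain_blk_insert (N := N) (A := A)) => //; last first.
- by rewrite -catA.
- exact: near_end_leq leN (rich_near_end A0 (rw R)).
move=> u leu uA; apply/orP; right.
apply: subseq_trans (prefix_subseq _ _); apply: (rich_pow (A := A) (N := N)) => //.
by apply: (rich_leq _ (rw (n - R))); lia.
Qed.

Lemma DA_lang_bool_comb (C : set (language Sigma)) L :
  (forall A, C A -> DA_lang A) -> bool_comb C L -> DA_lang L.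
Proof.
move=> sub; elim=> {L} [A /sub //||A B _ [n HA] _ [m HB]|A _ [n HA]].
- by exists 0.
- exists (maxn n m) => k le x y p q /=.
  have [h1 h2] : n <= k /\ m <= k by lia.
  by split=> -[/(HA _ h1)|/(HB _ h2)]; [left|right|left|right].
- by exists n => k le x y p q /=; split; apply: contra_not => /(HA _ le).
Qed.

Lemma threshold_dot_depth_one_DA_lang L : threshold_dot_depth_one L -> DA_lang L.
Proof.
have nil x y : x ++ y = [::] -> x = [::] /\ y = [::] by case: x => //; case: y.
apply: DA_lang_bool_comb => _ [u u0|u u0|l us _ us0 _].
- exists (size u) => n le x y p q /=; rewrite suffix_langE /=.
  have [/nil[-> ->]|/eqP xy0] := eqVneq (x ++ y) [::]; first by rewrite word_pow_nil.
  have le' : size u <= size (word_pow (x ++ y) n ++ q).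
    by rewrite size_cat (leq_trans le) // (leq_trans (size_word_pow_geq n xy0)) // leq_addr.
  by rewrite !catA -!(catA _ _ q) !(suffix_catr_le _ le').
- exists (size u) => n le x y p q /=; rewrite prefix_langE /=.
  have [/nil[-> ->]|/eqP xy0] := eqVneq (x ++ y) [::]; first by rewrite word_pow_nil.
  have le' : size u <= size (p ++ word_pow (x ++ y) n).
    by rewrite size_cat (leq_trans le) // (leq_trans (size_word_pow_geq n xy0)) // leq_addl.
  by rewrite !(catA p) !(prefix_catl_le _ le').
- by rewrite threshold_langE //; exact: threshold_lang_DA.
Qed.

Lemma DA_lang_eventually_DA L : DA_lang L -> eventually_DA (synt_monoid L).
Proof.
case=> N H; exists N => n le a b.
rewrite -(synt_morph_repr a) -(synt_morph_repr b).
have mu1 : synt_morph L [::] = 1%g by [].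
have muM u v : synt_morph L (u ++ v) = (synt_morph L u * synt_morph L v)%g.
  exact: synt_morphM.
have powE : ((synt_morph L (repr a) * synt_morph L (repr b)) ^+ n)%g =
    synt_morph L (word_pow (repr a ++ repr b) n).
  by rewrite (morph_pow mu1 muM) muM.
rewrite powE; set z := word_pow _ n.
transitivity (synt_morph L (z ++ repr a ++ z)).
  by rewrite muM (muM (repr a)) mulgA.
by apply/synt_morph_eq/asboolP => p q; rewrite -!catA; apply: H.
Qed.

Lemma wequiv_synt_cong L n k : (forall u v, wequiv n k u v -> L u -> L v) ->
  forall u v, wequiv n.+1 k u v -> synt_morph L u = synt_morph L v.
Proof.
move=> sat u v uv; apply/synt_morph_eq/asboolP => x y.
have H := wequiv_cat x y uv.
by split; apply: sat; [exact: H | exact: wequiv_sym].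
Qed.

Lemma windows_size n (w : seq Sigma) W : W \in windows n w -> size W <= n.
Proof.
elim: w => //= a w IH; rewrite in_cons => /orP[/eqP ->|/IH //].
by rewrite size_take; case: ltnP.
Qed.

Lemma dot_depth_one_finite L : dot_depth_one L -> finite_set [set: synt_monoid L].
Proof.
case/dot_depth_one_wequiv => n [k /wequiv_synt_cong sat].
pose words := words_upto (enum Sigma) n.+1.
pose ws := words_upto words k.
have wordsP w : size w <= n.+1 -> w \in words.
  by move=> le; rewrite mem_words_upto le; apply/allP => a _; rewrite /= mem_enum.
pose f1 (a : synt_monoid L) := [seq take n.+1 (repr a) == p | p <- words].
pose f2 (a : synt_monoid L) := [seq subseq b (windows n.+1 (repr a)) | b <- ws].
pose B := size words + size ws.
apply: (@finite_inj _ _ (fun a => f1 a ++ f2 a)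
    [set` words_upto [:: true; false] B]); last exact: finite_seq.
  move=> a c /eqP; rewrite eqseq_cat ?size_map // => /andP[/eqP/eq_in_map E1 /eqP/eq_in_map E2].
  rewrite -(synt_morph_repr a) -(synt_morph_repr c); apply: sat; split.
    have := E1 (take n.+1 (repr a)); rewrite eqxx => /(_ _)/esym/eqP -> //.
    by apply: wordsP; rewrite size_take; case: ltnP.
  move=> b leb; have [/E2 //|nb] := boolP (b \in ws).
  have no w : subseq b (windows n.+1 w) = false.
    apply: contraNF nb => bw; rewrite mem_words_upto leb /=; apply/allP => W Wb.
    exact/wordsP/(windows_size (mem_subseq bw Wb)).
  by rewrite !no.
move=> a; suff: f1 a ++ f2 a \in words_upto [:: true; false] B by [].
by rewrite mem_words_upto size_cat !size_map leqnn; apply/allP => -[].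
Qed.

Lemma finite_synt_semigroup L :
  finite_set [set: synt_monoid L] -> finite_set [set: synt_semigroup L].
Proof. exact: (finite_subsemigroup (synt_semigroup L)). Qed.

(** Choosing for each letter of [G] a non-empty word with the right syntactic value turns [phi] into
    the syntactic morphism after a nonerasing substitution. *)
Lemma dot_depth_one_windows_semigroup L :
  dot_depth_one L -> windows_semigroup (synt_semigroup L).
Proof.
move=> dd; split; first exact/finite_synt_semigroup/dot_depth_one_finite.
move=> G phi phiM; have [n [k sat]] := dot_depth_one_wequiv dd.
have /choice[h hP] : forall a : G, exists w, w <> [::] /\ synt_morph L w = val (phi [:: a]).
  by move=> a; have /asboolP[w w0 wE] := valP (phi [:: a]); exists w.
exists n.+1, k => u v u0 v0 uv; apply: val_inj.
have E (w : seq G) : w <> [::] -> val (phi w) = synt_morph L (flatten (map h w)).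
  elim: w => // a [|b w] IH _; first by rewrite /= cats0 (hP a).2.
  rewrite -cat1s phiM // map_cat flatten_cat synt_morphM -IH //.
  by rewrite -[flatten _]/(h a ++ [::]) cats0 (hP a).2.
rewrite !E //; apply/synt_morph_eq/asboolP => x y.
have h0 a : h a <> [::] := (hP a).1.
have H := wequiv_morphism h0 x y uv.
by split; apply: sat; [exact: H | exact: wequiv_sym].
Qed.

End Languages.

(** * The characterisation *)

Lemma JstarD_windows_semigroup S : JstarD S -> windows_semigroup S.
Proof.
move/(_ _ windows_semigroup_variety); apply=> T [G [L [dd ->]]].
exact: dot_depth_one_windows_semigroup.
Qed.

Lemma DA_JstarD_threshold (Sigma : finType) (L : language Sigma) : DA (synt_monoid L) -> JstarD (synt_semigroup L) ->
  threshold_dot_depth_one L.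
Proof.
move=> da /JstarD_windows_semigroup[_ W].
(* Over the empty alphabet there is only the empty word. Otherwise the letter [a0] supplies the junk
   value of [phi] at the empty word. *)
have [[a0 _]|no] := pselect (exists a : Sigma, True); last first.
  apply: (@bool_comb_tests _ _ bool [::] (fun=> set0)) => // u v _.
  by case: u v => [|a u] [|b v] //; case: no; [exists b | exists a | exists a].
have pl w : w <> [::] -> synt_plus (synt_morph L w).
  by move=> w0; apply/asboolP; exists w.
have a0p : [:: a0] <> [::] by [].
pose phi w : synt_semigroup L :=
  if pselect (w <> [::]) is left w0 then exist (@synt_plus Sigma L) _ (pl w w0)
  else exist (@synt_plus Sigma L) _ (pl _ a0p).
have phiE w : w <> [::] -> val (phi w) = synt_morph L w.
  by rewrite /phi; case: pselect.
have [|n [k nk]] := W Sigma phi.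
  move=> u v u0 v0; apply: val_inj; rewrite phiE; last by case: (u) u0.
  by rewrite synt_morphM (@valM _ _ (synt_semigroup L)) !phiE.
pose N := (n + k * n.+1).+1; pose K := k.+2.
have [c rep] := finite_repeat da.1.
pose words := words_upto (enum Sigma) N.
pose F (i : seq Sigma + seq Sigma + nat * seq (seq Sigma)) : language Sigma :=
  match i with
  | inl (inl p) => [set w | prefix p w]
  | inl (inr p) => [set w | suffix p w]
  | inr (l, us) => [set w | chain (blk l) us w]
  end.
pose tests := map inl (map inl words ++ map inr words) ++
  map inr (allpairs pair (iota 0 (max_threshold Sigma N K c).+1) (smalls Sigma N K)).
apply: (bool_comb_tests (s := tests) (F := F)) => [[[p|p]|[l us]] _|u v uv].
- exact: prefix_test_bool_comb.
- exact: suffix_test_bool_comb.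
- exact: threshold_test_bool_comb.
have wordsP p : size p <= N -> p \in words.
  by move=> le; rewrite mem_words_upto le; apply/allP => a _; rewrite /= mem_enum.
have preE p : size p <= N -> prefix p u = prefix p v.
  move=> /wordsP pw; apply/idP/idP; apply (uv (inl (inl p))) => //;
    by rewrite mem_cat map_f // mem_cat map_f.
have sufE p : size p <= N -> suffix p u = suffix p v.
  move=> /wordsP pw; apply/idP/idP; apply (uv (inl (inr p))) => //;
    by rewrite mem_cat map_f // mem_cat map_f // orbT.
have [|m [u' [v' [[cm Nm] uu' vv' cE]]]] := @threshold_saturation _ N K c u v.
  move=> l us lel sus; apply (uv (inr (l, us))).
  rewrite mem_cat; apply/orP; right; apply: map_f; apply: allpairs_f.
    by rewrite mem_iota /= add0n ltnS.
  by rewrite mem_smalls.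
have mu1 : synt_morph L [::] = 1%g by [].
have muM x y : synt_morph L (x ++ y) = (synt_morph L x * synt_morph L y)%g.
  exact: synt_morphM.
have val_ins := ins_value (DA_eventually da) mu1 muM rep cm.
have preE' p : size p <= N -> prefix p u' = prefix p v'.
  by move=> le; rewrite -(ins_prefix Nm le uu') -(ins_prefix Nm le vv') preE.
have sufE' p : size p <= N -> suffix p u' = suffix p v'.
  by move=> le; rewrite -(ins_suffix Nm le uu') -(ins_suffix Nm le vv') sufE.
have W' : wequiv n k u' v' by apply: (tests_wequiv (N := N) (K := K)).
apply: synt_morph_lang; rewrite (val_ins _ _ _ uu') (val_ins _ _ _ vv').
(* Since [N] is positive, [u'] and [v'] are both empty or both non-empty. *)
move: W' (prefix_tests_take preE'); case: (u') => [|a x]; case: (v') => [|b y] // W' _.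
by rewrite -!phiE // (nk _ _ _ _ W').
Qed.

Theorem theorem5p6 (Sigma : finType) :
  [set L : language Sigma | threshold_dot_depth_one L] =
    monoid_langs DA Sigma `&` semigroup_langs JstarD Sigma /\
  monoid_langs DA Sigma `&` semigroup_langs JstarD Sigma =
    semigroup_langs (fun S => DA_S S /\ JstarD S) Sigma.
Proof.
split; apply/seteqP; split=> L.
- move=> td; have dd := threshold_dot_depth_one_dot_depth_one td; split.
    apply: eventually_DA_DA (dot_depth_one_finite dd) _.
    exact/DA_lang_eventually_DA/threshold_dot_depth_one_DA_lang.
  by move=> V _; apply; exists Sigma, L.
- by case; exact: DA_JstarD_threshold.
(* The syntactic semigroup is a subsemigroup of the syntactic monoid. *)
- case=> da jd; split=> // V VV DAV.
  by apply: (variety_sub VV (synt_semigroup L)); apply: DAV; exists (synt_monoid L).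
- case=> das jd; split=> //; apply: DA_semigroup_synt; apply: das.
    exact: DA_semigroup_variety.
  by move=> _ [M da ->]; exact: DA_DA_semigroup.
Qed.
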